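(* Let $(P_n)_{n\geq 1}$ and $P$ be probability measures on $\big(\mathbb{D}([0,1];\mathbb{D}),\mathcal{D}_{\mathbb{D}}\big)$ such that: (1) $P_n \circ (\pi_{t_1,\ldots,t_k}^{\mathbb{D}})^{-1} \stackrel{w}{\to} P \circ (\pi_{t_1,\ldots,t_k}^{\mathbb{D}})^{-1}$ in $\mathbb{D}^k$, for any $k\ge 1$ and any $t_1,\ldots,t_k \in T_P$; (2) for any $\varepsilon>0$, (a) $\lim_{\delta \to 0}\limsup_{n \to \infty}P_n(\{x:\ w''(x(t),\delta) \geq \varepsilon \text{ for some } t \in [0,1]\})=0$, (b) $\lim_{\delta \to 0}\limsup_{n \to \infty}P_n(\{x:\ |x(t,\delta)-x(t,0)| \geq \varepsilon \text{ for some } t \in [0,1]\})=0$, (c) $\lim_{\delta \to 0}\limsup_{n \to \infty}P_n(\{x:\ |x(t,1-)-x(t,1-\delta)| \geq \varepsilon \text{ for some } t \in [0,1]\})=0$; (3) for any $\varepsilon>0$, $\lim_{\delta \to 0}\limsup_{n \to \infty}P_n(\{x:\ w_{\mathbb{D}}''(x,\delta) \geq \varepsilon \})=0$; (4) for any $\varepsilon>0$, $\lim_{\delta \to 0} P\big(\{x:\ d_{J_1}^0(x(1),x(1-\delta))\geq \varepsilon \} \big)=0$. Then $P_n \stackrel{w}{\to} P$.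
   Context: $\mathbb{D}$ is the set of functions $x:[0,1]\to\mathbb{R}$ that are right-continuous and have left limits, with $\|x\|=\sup_{s\in[0,1]}|x(s)|$. $\Lambda$ is the set of strictly increasing continuous functions from $[0,1]$ onto $[0,1]$, $e$ is the identity on $[0,1]$, and for $\lambda\in\Lambda$, $\|\lambda\|^0=\sup_{s<s'}\left|\log\frac{\lambda(s')-\lambda(s)}{s'-s}\right|$. The Skorohod $J_1$-topology on $\mathbb{D}$ is given by the (complete, separable) metric $d_{J_1}^0(x,y)=\inf_{\lambda\in\Lambda}\{\|\lambda\|^0\vee\|x-y\circ\lambda\|\}$; $\mathbb{D}^k$ carries the product topology. $\mathbb{D}([0,1];\mathbb{D})$ is the set of functions $x:[0,1]\to\mathbb{D}$ that are right-continuous at every $t\in[0,1)$ and have a left limit $x(t-)\in\mathbb{D}$ at every $t\in(0,1]$, both with respect to $d_{J_1}^0$. For $x\in\mathbb{D}([0,1];\mathbb{D})$, write $x(t,s)$ for the value of $x(t)\in\mathbb{D}$ at $s$, and $x(t,1-)=\lim_{s\uparrow 1}x(t,s)$. The space is equipped with the metric $d_{\mathbb{D}}(x,y)=\inf_{\lambda\in\Lambda}\{\|\lambda-e\|\vee\rho_{\mathbb{D}}(x,y\circ\lambda)\}$, where $\rho_{\mathbb{D}}(x,y)=\sup_{t\in[0,1]}d_{J_1}^0(x(t),y(t))$, and with its Borel $\sigma$-field $\mathcal{D}_{\mathbb{D}}$ for $d_{\mathbb{D}}$. $\stackrel{w}{\to}$ denotes weak convergence of probability measures. For $\delta\in(0,1)$: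 for $x\in\mathbb{D}$, $w''(x,\delta)=\sup\{|x(s)-x(s_1)|\wedge|x(s_2)-x(s)|:\ s_1\le s\le s_2,\ s_2-s_1\le\delta\}$; for $x\in\mathbb{D}([0,1];\mathbb{D})$, $w''_{\mathbb{D}}(x,\delta)=\sup\{d_{J_1}^0(x(t),x(t_1))\wedge d_{J_1}^0(x(t_2),x(t)):\ t_1\le t\le t_2,\ t_2-t_1\le\delta\}$ (all points in $[0,1]$). $\pi_t^{\mathbb{D}}(x)=x(t)$ and $\pi_{t_1,\dots,t_k}^{\mathbb{D}}(x)=(x(t_1),\dots,x(t_k))$ for $x\in\mathbb{D}([0,1];\mathbb{D})$. $T_P$ is the set of $t\in[0,1]$ such that $\pi_t^{\mathbb{D}}:(\mathbb{D}([0,1];\mathbb{D}),d_{\mathbb{D}})\to(\mathbb{D},J_1)$ is continuous at $P$-almost every $x$ (so $0,1\in T_P$, and for $t\in(0,1)$, $t\in T_P$ iff $P(\{x: x(t-)\ne x(t)\})=0$). *)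

(* Defs.v *)
From HB Require Import structures.
From mathcomp Require Import all_boot all_order all_algebra.
From mathcomp Require Import all_classical all_reals all_analysis.

Set Implicit Arguments.
Unset Strict Implicit.
Unset Printing Implicit Defensive.

Import Order.TTheory GRing.Theory Num.Theory.
Import numFieldNormedType.Exports.

Local Open Scope classical_set_scope.
Local Open Scope ring_scope.

Notation I01 R := (set_type `[0%R : R, 1%R]%classic).

Section unit_interval.
Variable R : realType.

Lemma zero_in01 : (0 : R) \in `[0%R, 1%R]%classic.
Proof. by apply/mem_set; rewrite /= in_itv /= lexx ler01. Qed.

(* The point of [0,1] with value r; it takes the junk value 0 when r is not
   in [0,1]. *)
Definition pt01 (r : R) : I01 R := insubd (exist _ 0 zero_in01 : I01 R) r.

Lemma pt01K (r : R) : 0 <= r <= 1 -> val (pt01 r) = r.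
Proof.
by move=> r01; rewrite val_insubd ifT//; apply/mem_set; rewrite /= in_itv.
Qed.

Lemma val_pt01 (t : I01 R) : pt01 (val t) = t.
Proof. by rewrite /pt01 valKd. Qed.

Lemma I01_ge0 (t : I01 R) : 0 <= val t.
Proof. by have /set_mem := valP t; rewrite /= in_itv /= => /andP[]. Qed.

Lemma I01_le1 (t : I01 R) : val t <= 1.
Proof. by have /set_mem := valP t; rewrite /= in_itv /= => /andP[]. Qed.

(* The one-sided limits at t are taken along real u, which eventually lie in
   [0,1]; so the junk values of pt01 play no role. *)
Definition cadlag (T : topologicalType) (x : I01 R -> T) : Prop :=
  (forall t : I01 R, val t < 1 -> x (pt01 u) @[u --> (val t)^'+] --> x t) /\
  (forall t : I01 R, 0 < val t ->
     exists l : T, x (pt01 u) @[u --> (val t)^'-] --> l).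

Lemma cadlag_cst (T : topologicalType) (a : T) : cadlag (fun=> a).
Proof.
by split=> [t _|t _]; [|exists a]; apply: cvg_cst.
Qed.

Definition Lambda : set (I01 R -> I01 R) :=
  [set lam : I01 R -> I01 R |
    [/\ continuous lam,
        forall s t : I01 R, val s < val t -> val (lam s) < val (lam t)
      & forall t, exists s, lam s = t]].

Definition log_norm (lam : I01 R -> I01 R) : \bar R :=
  ereal_sup [set r | exists s s' : I01 R, val s < val s' /\
    r = (`|ln ((val (lam s') - val (lam s)) / (val s' - val s))|)%:E].

Definition id_norm (lam : I01 R -> I01 R) : \bar R :=
  ereal_sup [set (`|val (lam t) - val t|)%:E | t in [set: I01 R]].

(* The pattern shared by the two Skorohod metrics:
   inf over lam of N lam \/ sup_t dst (x t) (y (lam t)). *)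
Definition skorohod_dist (T : Type) (N : (I01 R -> I01 R) -> \bar R)
    (dst : T -> T -> \bar R) (x y : I01 R -> T) : \bar R :=
  ereal_inf [set maxe (N lam)
                      (ereal_sup [set dst (x t) (y (lam t)) | t in [set: I01 R]])
            | lam in Lambda].

(* The modulus w'' for functions with values in a metric space (T, dst). *)
Definition modulus (T : Type) (dst : T -> T -> \bar R) (x : I01 R -> T)
    (delta : R) : \bar R :=
  ereal_sup [set r | exists t1 t t2 : I01 R,
    [/\ val t1 <= val t, val t <= val t2, val t2 - val t1 <= delta
      & r = mine (dst (x t) (x t1)) (dst (x t2) (x t))]].

Section Lambda_theory.

Lemma Lambda_id : Lambda id.
Proof. by split=> // [t|t]; [exact: cvg_id|exists t]. Qed.

Lemma Lambda_comp l m : Lambda l -> Lambda m -> Lambda (l \o m).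
Proof.
move=> [cl il sl] [cm im sm]; split.
- by move=> t; apply: continuous_comp; [exact: cm|exact: cl].
- by move=> s t /im/il.
- by move=> t; have [u <-] := sl t; have [v <-] := sm u; exists v.
Qed.

Lemma incr_le (l : I01 R -> I01 R) :
  (forall s t : I01 R, val s < val t -> val (l s) < val (l t)) ->
  forall s t : I01 R, (val (l s) < val (l t)) = (val s < val t).
Proof.
move=> il s t; apply/idP/idP; last exact: il.
apply: contraTT; rewrite -!leNgt le_eqVlt => /orP[/eqP/val_inj->//|/il/ltW//].
Qed.

Lemma I01_lt_nbhs (t b : I01 R) : val t < val b ->
  \forall s \near t, val s < val b.
Proof.
move=> tb.
have vc : {for t, continuous (set_val : I01 R -> R)} by exact: initial_continuous.
exact: (vc _ (lt_nbhsl tb)).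
Qed.

Lemma I01_gt_nbhs (t b : I01 R) : val b < val t ->
  \forall s \near t, val b < val s.
Proof.
move=> tb.
have vc : {for t, continuous (set_val : I01 R -> R)} by exact: initial_continuous.
exact: (vc _ (lt_nbhsr tb)).
Qed.

Lemma incr_onto_continuous (l : I01 R -> I01 R) :
  (forall s t : I01 R, val s < val t -> val (l s) < val (l t)) ->
  (forall t, exists s, l s = t) -> continuous l.
Proof.
move=> il sl.
suff vl : continuous (set_val \o l : I01 R -> R).
  exact: (@continuous_comp_initial _ _ _ set_val l vl).
move=> t.
suff H : forall e : R, 0 < e ->
    \forall s \near t, `|(val (l t) : R) - (val (l s) : R)| < e.
  move=> U /nbhs_ballP[e e0 eU].
  by apply: (@filterS _ (nbhs t) _ _ _ _ (H e e0)) => s ls; exact: eU.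
move=> e e0.
have h2 : 0 < e / 2 by rewrite divr_gt0.
have h2e : e / 2 < e by rewrite ltr_pdivrMr// ltr_pMr// ltr1n.
have up : \forall s \near t, val (l s) < val (l t) + e.
  have [h1|h1] := leP (val (l t) + e / 2) 1; last first.
    near=> s; apply: (le_lt_trans (I01_le1 _)); apply: (lt_trans h1).
    by rewrite ltrD2l.
  have [b lb] := sl (pt01 (val (l t) + e / 2)).
  have vb : val (l b) = val (l t) + e / 2.
    by rewrite lb pt01K// h1 andbT addr_ge0 ?I01_ge0// ltW.
  have tb : val t < val b by rewrite -(incr_le il) vb ltrDl.
  apply: filterS (I01_lt_nbhs tb) => s sb.
  by apply: (lt_trans (il _ _ sb)); rewrite vb ltrD2l.
have lo : \forall s \near t, val (l t) - e < val (l s).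
  have [h1|h1] := leP 0 (val (l t) - e / 2); last first.
    near=> s; apply: lt_le_trans (I01_ge0 _); apply: lt_trans h1.
    by rewrite ltrD2l ltrN2.
  have [b lb] := sl (pt01 (val (l t) - e / 2)).
  have vb : val (l b) = val (l t) - e / 2.
    rewrite lb pt01K// h1 /=; apply: le_trans (I01_le1 (l t)).
    by rewrite gerBl ltW.
  have tb : val b < val t by rewrite -(incr_le il) vb gtrBl.
  apply: filterS (I01_gt_nbhs tb) => s sb.
  by apply: lt_trans (il _ _ sb); rewrite vb ltrD2l ltrN2.
near=> s; rewrite /= distrC ltr_distl; apply/andP; split.
- by near: s.
- by near: s.
Unshelve. all: by end_near. Qed.

Lemma Lambda_inv l : Lambda l ->
  exists m, [/\ Lambda m, cancel l m & cancel m l].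
Proof.
move=> [cl il sl]; have [m mK] := choice sl.
have lK : cancel l m.
  move=> t; apply: val_inj; have := mK (l t).
  by case: (ltgtP (val (m (l t))) (val t)) => // /il + e; rewrite e ltxx.
have im (s t : I01 R) : val s < val t -> val (m s) < val (m t).
  by rewrite -(incr_le il (m s)) !mK.
have sm t : exists s, m s = t by exists (l t).
by exists m; split => //; split => //; exact: incr_onto_continuous.
Qed.

Lemma log_norm_id : log_norm id = 0%E.
Proof.
rewrite /log_norm (_ : [set _ | _] = [set 0%E]) ?ereal_sup1//.
apply/seteqP; split => [_ [s [s' [ss' ->]]]|_ ->] /=.
  by rewrite divff ?ln1 ?normr0// subr_eq0 gt_eqF.
exists (pt01 0), (pt01 1); rewrite !pt01K ?ltr01 ?lexx ?ler01//; split => //.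
by rewrite subr0 divr1 ln1 normr0.
Qed.

Lemma id_norm_id : id_norm id = 0%E.
Proof.
rewrite /id_norm (_ : [set _ | _ in _] = [set 0%E]) ?ereal_sup1//.
apply/seteqP; split => [_ [s _ <-]|_ ->] /=; first by rewrite subrr normr0.
by exists (pt01 0) => //; rewrite subrr normr0.
Qed.

Lemma log_norm_inv l m : Lambda l -> Lambda m -> cancel l m -> cancel m l ->
  (log_norm m <= log_norm l)%E.
Proof.
move=> [_ il _] [_ im _] lK mK; apply: ge_ereal_sup => _ [s [s' [ss' ->]]].
apply: ereal_sup_ubound; exists (m s), (m s'); split; first exact: im.
congr (_%:E); rewrite !mK -[in RHS]invf_div lnV ?normrN//.
by rewrite posrE divr_gt0 ?subr_gt0 ?im.
Qed.

Lemma id_norm_inv l m : Lambda l -> Lambda m -> cancel l m -> cancel m l ->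
  (id_norm m <= id_norm l)%E.
Proof.
move=> _ _ lK mK; apply: ge_ereal_sup => _ [s _ <-].
by apply: ereal_sup_ubound; exists (m s) => //; rewrite mK distrC.
Qed.

Lemma ler_norm_ln_div (a b c : R) : 0 < a -> 0 < b -> 0 < c ->
  `|ln (a / c)| <= `|ln (a / b)| + `|ln (b / c)|.
Proof.
move=> a0 b0 c0.
have -> : a / c = a / b * (b / c) by rewrite mulrA divfK// gt_eqF.
have ab : a / b \in Num.pos by rewrite posrE divr_gt0.
have bc : b / c \in Num.pos by rewrite posrE divr_gt0.
by rewrite (lnM ab bc) ler_normD.
Qed.

Lemma log_norm_comp l m : Lambda l -> Lambda m ->
  (log_norm (l \o m) <= log_norm l + log_norm m)%E.
Proof.
move=> [_ il _] [_ im _]; apply: ge_ereal_sup => _ [s [s' [ss' ->]]].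
have h1 : 0 < val (m s') - val (m s) by rewrite subr_gt0 im.
have h2 : 0 < val (l (m s')) - val (l (m s)) by rewrite subr_gt0 il// im.
have h3 : 0 < val s' - val s by rewrite subr_gt0.
apply: (@le_trans _ _
  ((`|ln ((val (l (m s')) - val (l (m s))) / (val (m s') - val (m s)))|)%:E +
   (`|ln ((val (m s') - val (m s)) / (val s' - val s))|)%:E)%E).
  by rewrite -EFinD lee_fin; exact: ler_norm_ln_div.
apply: leeD; apply: ereal_sup_ubound; last by exists s, s'.
by exists (m s), (m s'); split => //; exact: im.
Qed.

Lemma id_norm_comp l m : Lambda l -> Lambda m ->
  (id_norm (l \o m) <= id_norm l + id_norm m)%E.
Proof.
move=> _ _; apply: ge_ereal_sup => _ [s _ <-].
apply: (@le_trans _ _ ((`|val (l (m s)) - val (m s)|)%:E +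
                       (`|val (m s) - val s|)%:E)%E).
  by rewrite -EFinD lee_fin /= ler_distD.
by apply: leeD; apply: ereal_sup_ubound; [exists (m s)|exists s].
Qed.

End Lambda_theory.

Section skorohod_dist_theory.
Local Open Scope ereal_scope.
Variables (T : Type) (N : (I01 R -> I01 R) -> \bar R) (dst : T -> T -> \bar R).
Hypothesis N_id : N id = 0.
Hypothesis N_inv : forall l m, Lambda l -> Lambda m ->
  cancel l m -> cancel m l -> N m <= N l.
Hypothesis N_comp : forall l m, Lambda l -> Lambda m ->
  N (l \o m) <= N l + N m.
Hypothesis dst_ge0 : forall a b, 0 <= dst a b.
Hypothesis dst_refl : forall a, dst a a = 0.
Hypothesis dst_sym : forall a b, dst a b = dst b a.
Hypothesis dst_triangle : forall b a c, dst a c <= dst a b + dst b c.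

Let sup_dst (x y : I01 R -> T) (l : I01 R -> I01 R) :=
  ereal_sup [set dst (x t) (y (l t)) | t in [set: I01 R]].

Lemma sup_dst_ge0 x y l : 0 <= sup_dst x y l.
Proof using dst_ge0.
apply: (le_trans (dst_ge0 (x (pt01 0)) (y (l (pt01 0))))).
by apply: ereal_sup_ubound; exists (pt01 0).
Qed.

Lemma skorohod_dist_ge0 x y : 0 <= skorohod_dist N dst x y.
Proof using dst_ge0.
apply: le_ereal_inf_tmp => _ [l _ <-].
by rewrite le_max sup_dst_ge0 orbT.
Qed.

Lemma skorohod_dist_refl x : skorohod_dist N dst x x = 0.
Proof using N_id dst_ge0 dst_refl.
apply/eqP; rewrite eq_le skorohod_dist_ge0 andbT.
apply: ereal_inf_lbound; exists id; first exact: Lambda_id.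
rewrite N_id /=.
rewrite (_ : [set _ | _ in _] = [set 0]) ?ereal_sup1 ?maxxx//.
apply/seteqP; split => [_ [t _ <-]|_ ->] /=; first by rewrite dst_refl.
by exists (pt01 0) => //; rewrite dst_refl.
Qed.

Lemma skorohod_dist_le_sym x y :
  skorohod_dist N dst x y <= skorohod_dist N dst y x.
Proof using N_inv dst_sym.
apply: le_ereal_inf_tmp => _ [l Ll <-].
have [m [Lm lK mK]] := Lambda_inv Ll.
apply: (@le_trans _ _ (maxe (N m) (sup_dst x y m))).
  by apply: ereal_inf_lbound; exists m.
rewrite ge_max !le_max N_inv//=; apply/orP; right.
apply: ge_ereal_sup => _ [t _ <-]; apply: ereal_sup_ubound.
by exists (m t) => //; rewrite mK dst_sym.
Qed.

Lemma skorohod_dist_sym x y : skorohod_dist N dst x y = skorohod_dist N dst y x.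
Proof using N_inv dst_sym. by apply/eqP; rewrite eq_le !skorohod_dist_le_sym. Qed.

Lemma skorohod_dist_triangle y x z :
  skorohod_dist N dst x z <= skorohod_dist N dst x y + skorohod_dist N dst y z.
Proof using N_comp dst_ge0 dst_triangle.
rewrite leNgt; apply/negP => xyz.
have yz0 := skorohod_dist_ge0 y z; have xy0 := skorohod_dist_ge0 x y.
have yzf : skorohod_dist N dst y z \is a fin_num.
  rewrite ge0_fin_numE//; apply: lt_le_trans (leey _).
  by apply: le_lt_trans xyz; rewrite leeDr.
have := xyz; rewrite -lteBrDr// => /ereal_inf_lt[_ [l Ll <-] hl].
have lf : maxe (N l) (sup_dst x y l) \is a fin_num.
  rewrite ge0_fin_numE ?le_max ?sup_dst_ge0 ?orbT//.
  by apply: lt_le_trans hl (leey _).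
have := hl; rewrite lteBrDr// addeC -lteBrDr// => /ereal_inf_lt[_ [m Lm <-] hm].
move: hm; rewrite lteBrDr// addeC; apply/negP; rewrite -leNgt.
apply: (@le_trans _ _ (maxe (N (m \o l)) (sup_dst x z (m \o l)))).
  by apply: ereal_inf_lbound; exists (m \o l) => //; exact: Lambda_comp.
rewrite ge_max; apply/andP; split.
  by rewrite (le_trans (N_comp Lm Ll))// addeC leeD// le_max lexx.
apply: ge_ereal_sup => _ [t _ <-] /=.
apply: (le_trans (dst_triangle (y (l t)) _ _)).
by apply: leeD; rewrite le_max; apply/orP; right; apply: ereal_sup_ubound;
  [exists t|exists (l t)].
Qed.

End skorohod_dist_theory.

End unit_interval.
Arguments pt01 {R} r.
Arguments Lambda {R}.
Arguments cadlag_cst {R T} a.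

(* An extended-real valued distance d generates a pseudometric structure with
   the balls [set y | d x y < e]. *)
Section dist_ball.
Local Open Scope ereal_scope.
Variables (R : realType) (T : Type) (d : T -> T -> \bar R).
Definition dist_ball (x : T) (e : R) : set T := [set y | d x y < e%:E].

Hypothesis d_ge0 : forall x y, 0 <= d x y.
Hypothesis d_refl : forall x, d x x = 0.
Hypothesis d_sym : forall x y, d x y = d y x.
Hypothesis d_triangle : forall y x z, d x z <= d x y + d y z.

Lemma dist_ball_center x (e : R) : (0 < e)%R -> dist_ball x e x.
Proof. by move=> e0; rewrite /dist_ball /= d_refl lte_fin. Qed.

Lemma dist_ball_sym x y (e : R) : dist_ball x e y -> dist_ball y e x.
Proof. by rewrite /dist_ball /= d_sym. Qed.

Lemma dist_ball_triangle x y z (e1 e2 : R) :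
  dist_ball x e1 y -> dist_ball y e2 z -> dist_ball x (e1 + e2)%R z.
Proof.
move=> xy yz; apply: le_lt_trans (d_triangle y _ _) _.
by rewrite EFinD lteD.
Qed.

End dist_ball.

Section real_dist.
Variable R : realType.
Local Open Scope ereal_scope.

Definition real_dist (a b : R) : \bar R := (`|a - b|%R)%:E.

Lemma real_dist_ge0 a b : 0 <= real_dist a b.
Proof. by rewrite lee_fin. Qed.

Lemma real_dist_refl a : real_dist a a = 0.
Proof. by rewrite /real_dist subrr normr0. Qed.

Lemma real_dist_sym a b : real_dist a b = real_dist b a.
Proof. by rewrite /real_dist distrC. Qed.

Lemma real_dist_triangle b a c : real_dist a c <= real_dist a b + real_dist b c.
Proof. by rewrite -EFinD lee_fin ler_distD. Qed.

End real_dist.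

Record D (R : realType) := MkD {
  D_fun :> I01 R -> R ;
  D_cadlag : cadlag D_fun }.

Definition dJ1 (R : realType) (x y : D R) : \bar R :=
  skorohod_dist (@log_norm R) (@real_dist R) x y.

Section D_structures.
Variable R : realType.

Lemma dJ1_ge0 (x y : D R) : (0 <= dJ1 x y)%E.
Proof. by apply: skorohod_dist_ge0; exact: real_dist_ge0. Qed.

Lemma dJ1_refl (x : D R) : dJ1 x x = 0%E.
Proof.
apply: skorohod_dist_refl;
  [exact: log_norm_id | exact: real_dist_ge0 | exact: real_dist_refl].
Qed.

Lemma dJ1_sym (x y : D R) : dJ1 x y = dJ1 y x.
Proof.
by apply: skorohod_dist_sym; [exact: log_norm_inv | exact: real_dist_sym].
Qed.

Lemma dJ1_triangle (y x z : D R) : (dJ1 x z <= dJ1 x y + dJ1 y z)%E.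
Proof.
by apply: skorohod_dist_triangle;
  [exact: log_norm_comp | exact: real_dist_ge0 | exact: real_dist_triangle].
Qed.

HB.instance Definition _ := gen_eqMixin (D R).
HB.instance Definition _ := gen_choiceMixin (D R).
HB.instance Definition _ := isPointed.Build (D R) (MkD (cadlag_cst (0 : R))).

Let ball := dist_ball (@dJ1 R).
Let ent := entourage_ ball.
Let nb (x : D R) := nbhs_ ent x.
HB.instance Definition _ := hasNbhs.Build (D R) nb.
HB.instance Definition _ := @Nbhs_isPseudoMetric.Build R (D R) ent
  (erefl : nbhs = nbhs_ ent) ball (dist_ball_center dJ1_refl)
  (dist_ball_sym dJ1_sym) (dist_ball_triangle dJ1_triangle) (erefl : ent = _).

End D_structures.

(* Right-continuity and left limits refer to the topology of dJ1 on D R. *)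
Record DD (R : realType) := MkDD {
  DD_fun :> I01 R -> D R ;
  DD_cadlag : cadlag DD_fun }.

Definition dD (R : realType) (x y : DD R) : \bar R :=
  skorohod_dist (@id_norm R) (@dJ1 R) x y.

Section DD_structures.
Variable R : realType.

Lemma dD_ge0 (x y : DD R) : (0 <= dD x y)%E.
Proof. by apply: skorohod_dist_ge0; exact: dJ1_ge0. Qed.

Lemma dD_refl (x : DD R) : dD x x = 0%E.
Proof.
apply: skorohod_dist_refl;
  [exact: id_norm_id | exact: dJ1_ge0 | exact: dJ1_refl].
Qed.

Lemma dD_sym (x y : DD R) : dD x y = dD y x.
Proof.
by apply: skorohod_dist_sym; [exact: id_norm_inv | exact: dJ1_sym].
Qed.

Lemma dD_triangle (y x z : DD R) : (dD x z <= dD x y + dD y z)%E.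
Proof.
by apply: skorohod_dist_triangle;
  [exact: id_norm_comp | exact: dJ1_ge0 | exact: dJ1_triangle].
Qed.

HB.instance Definition _ := gen_eqMixin (DD R).
HB.instance Definition _ := gen_choiceMixin (DD R).
HB.instance Definition _ :=
  isPointed.Build (DD R) (MkDD (cadlag_cst (point : D R))).

Let ball := dist_ball (@dD R).
Let ent := entourage_ ball.
Let nb (x : DD R) := nbhs_ ent x.
HB.instance Definition _ := hasNbhs.Build (DD R) nb.
HB.instance Definition _ := @Nbhs_isPseudoMetric.Build R (DD R) ent
  (erefl : nbhs = nbhs_ ent) ball (dist_ball_center dD_refl)
  (dist_ball_sym dD_sym) (dist_ball_triangle dD_triangle) (erefl : ent = _).

End DD_structures.

(* D^k with the product topology. *)
Definition Dpow (R : realType) (k : nat) : Type := {ptws 'I_k -> D R}.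

HB.instance Definition _ (R : realType) (k : nat) :=
  Topological.copy (Dpow R k) {ptws 'I_k -> D R}.
HB.instance Definition _ (R : realType) (k : nat) :=
  Pointed.copy (Dpow R k) ('I_k -> D R).

Notation borel T := (g_sigma_algebraType (@open T)).

(* The mu_ n and mu are bare set functions only so that pushforwards can be
   used without carrying measurability proofs. *)
Definition weak_cvg (R : realType) (T : ptopologicalType)
    (mu_ : nat -> set (borel T) -> \bar R) (mu : set (borel T) -> \bar R) :=
  forall f : T -> R, continuous f -> (exists M : R, forall x, `|f x| <= M) ->
    (\int[mu_ n]_x (f x)%:E)%E @[n --> \oo] --> (\int[mu]_x (f x)%:E)%E.
Arguments weak_cvg {R} T mu_ mu.

Definition w2 (R : realType) (x : D R) (delta : R) : \bar R :=
  modulus (@real_dist R) x delta.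

Definition w2D (R : realType) (x : DD R) (delta : R) : \bar R :=
  modulus (@dJ1 R) x delta.

Definition lim1 (R : realType) (x : D R) : R := lim (x (pt01 s) @[s --> 1^'-]).

Definition proj (R : realType) (t : I01 R) (x : DD R) : D R := x t.

Definition projs (R : realType) (k : nat) (t : 'I_k -> I01 R) (x : borel (DD R)) :
    borel (Dpow R k) :=
  fun i => proj (t i) x.

Definition TP (R : realType) (P : set (borel (DD R)) -> \bar R) : set (I01 R) :=
  [set t | {ae P, forall x : DD R, {for x, continuous (@proj R t)}}].

(* Outer probability: the infimum of the total P-mass of the countable
   measurable covers of A. It equals P A for measurable A (measurable_mu_extE),
   and is meaningful for every A, whereas P A is arbitrary when A is not
   measurable. *)
Definition outer_prob (R : realType) (P : probability (borel (DD R)) R)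
  (A : set (DD R)) : \bar R := mu_ext P A.

(* Main.v *)
Require Import Defs.
From mathcomp Require Import all_boot all_order all_algebra.
From mathcomp Require Import all_classical all_reals all_analysis.
From mathcomp Require Import measurable_realfun lra.
Import Order.TTheory GRing.Theory Num.Theory.
Import numFieldNormedType.Exports.
Set Implicit Arguments.
Unset Strict Implicit.
Unset Printing Implicit Defensive.
Local Open Scope classical_set_scope.
Local Open Scope ring_scope.

(** The idea is to compare a path x with the path obtained by sampling it on a
    finite grid, and to treat the sampled paths by finite-dimensional
    convergence.

    Sampling on a grid u 0 < ... < u K is the composition of the evaluations at
    the grid points with a continuous map from D^(K+1) to DD.  If the grid
    consists of times in TP, finite-dimensional convergence therefore gives
    the convergence of the expectations of every bounded continuous function of
    the sampled path.  Such grids exist with arbitrarily small mesh because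
    the complement of TP is countable (countable_not_TP): a path has finitely
    many jumps of a given size, so only finitely many times can carry such a
    jump with a given probability.

    It remains to see that sampling moves x only a little, uniformly in n.  When
    the modulus w2D x delta is small and the mesh is at most delta, x has in
    each cell of the grid essentially one large move, from the value at the left
    end to the value at the right end (w2D_switch).  A time change that shifts
    these moves to the right ends of the cells makes x close to its sampled path
    (rD_sample_w2D).  The move in the last cell cannot be shifted to 1, and this
    costs the distance between the values of x at 1 and at the last interior
    grid point.  That distance is small in expectation under P by the
    continuity assumption at 1, hence also under P_ n for large n, because it
    depends on x through two grid points only.  Under P itself, sampled
    paths converge to the path as the mesh vanishes (rD_sample_small), and
    dominated convergence applies.

    The error is measured in the metric of DD, so the argument requires test
    functions that are Lipschitz.  Monotone approximation of a bounded
    continuous function by infimal convolutions (inf_conv) reduces the general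
    case to that one (weak_cvg_lipschitz). *)


(** * Truncated real-valued distances *)
Section truncated_distance.
Context {R : realType} {T : Type} (d : T -> T -> \bar R).
Hypothesis d_ge0 : forall x y, (0 <= d x y)%E.
Hypothesis d_refl : forall x, d x x = 0%E.
Hypothesis d_sym : forall x y, d x y = d y x.
Hypothesis d_triangle : forall y x z, (d x z <= d x y + d y z)%E.

(** Truncating at 1 turns an extended-real distance into a bounded real one
    with the same small balls.  All estimates below are then inequalities
    between real numbers, and distances can be integrated. *)
Definition trunc_dist (x y : T) : R := fine (mine (d x y) 1%E).

Lemma trunc_distE x y : (trunc_dist x y)%:E = mine (d x y) 1%E.
Proof using d_ge0.
rewrite /trunc_dist fineK// ge0_fin_numE ?le_min ?d_ge0 ?lee01//.
by rewrite gt_min ltry orbT.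
Qed.

Lemma trunc_dist_ge0 x y : 0 <= trunc_dist x y.
Proof using d_ge0. by rewrite -lee_fin trunc_distE le_min d_ge0 lee01. Qed.

Lemma trunc_dist_le1 x y : trunc_dist x y <= 1.
Proof using d_ge0. by rewrite -lee_fin trunc_distE ge_min lexx orbT. Qed.

Lemma trunc_dist_refl x : trunc_dist x x = 0.
Proof using d_refl. by rewrite /trunc_dist d_refl /mine lte01. Qed.

Lemma trunc_dist_sym x y : trunc_dist x y = trunc_dist y x.
Proof using d_sym. by rewrite /trunc_dist d_sym. Qed.

Lemma trunc_dist_triangle y x z :
  trunc_dist x z <= trunc_dist x y + trunc_dist y z.
Proof using d_ge0 d_triangle.
rewrite -lee_fin EFinD !trunc_distE ge_min.
have [xy|xy] := leP 1%E (d x y).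
  by rewrite leeDl ?orbT// le_min d_ge0 lee01.
have [yz|yz] := leP 1%E (d y z).
  by rewrite leeDr ?orbT//.
by rewrite d_triangle.
Qed.

Lemma trunc_dist_le_dist x y : ((trunc_dist x y)%:E <= d x y)%E.
Proof using d_ge0. by rewrite trunc_distE ge_min lexx. Qed.

Lemma trunc_dist_lt (e : R) x y : e <= 1 ->
  (trunc_dist x y < e) = (d x y < e%:E)%E.
Proof using d_ge0.
move=> e1; rewrite -lte_fin trunc_distE gt_min.
by rewrite [X in _ || X]ltNge lee_fin e1 orbF.
Qed.

Lemma trunc_dist_le (e : R) x y : e < 1 ->
  (trunc_dist x y <= e) = (d x y <= e%:E)%E.
Proof using d_ge0.
move=> e1; rewrite -lee_fin trunc_distE ge_min.
by rewrite [X in _ || X]leNgt lte_fin e1 orbF.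
Qed.

Lemma dist_ball_trunc x (U : set T) : nbhs_ball_ (dist_ball d) x U <->
  exists2 e, 0 < e & forall y, trunc_dist x y < e -> U y.
Proof using d_ge0.
have min1 (e : R) : Num.min e 1 <= 1 by rewrite ge_min lexx orbT.
split=> [[e /= e0 eU]|[e e0 eU]]; exists (Num.min e 1);
  rewrite /= ?lt_min ?e0 ?ltr01// => y /=.
  rewrite trunc_dist_lt// => xy; apply: eU; apply: (lt_le_trans xy).
  by rewrite lee_fin ge_min lexx.
rewrite /dist_ball/= -trunc_dist_lt// => xy; apply: eU.
by apply: (lt_le_trans xy); rewrite ge_min lexx.
Qed.

End truncated_distance.

(** * The metrics of D and DD in terms of real numbers *)
Section time_coordinate.
Context {R : realType}.

Definition tm (t : I01 R) : R := \val t.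

Lemma tm_ge0 t : 0 <= tm t. Proof. exact: I01_ge0. Qed.
Lemma tm_le1 t : tm t <= 1. Proof. exact: I01_le1. Qed.
Lemma tm_inj : injective tm. Proof. exact: val_inj. Qed.
Lemma tmK t : pt01 (tm t) = t. Proof. exact: val_pt01. Qed.
Lemma pt01_tm r : 0 <= r <= 1 -> tm (pt01 r) = r. Proof. exact: pt01K. Qed.

Lemma tm0 : tm (pt01 0) = 0. Proof. by rewrite pt01_tm// lexx ler01. Qed.
Lemma tm1 : tm (pt01 1) = 1. Proof. by rewrite pt01_tm// lexx ler01. Qed.

End time_coordinate.
Arguments tm : simpl never.

Section real_metrics.
Context {R : realType}.

Definition rJ1 : D R -> D R -> R := trunc_dist (@dJ1 R).
Definition rD : DD R -> DD R -> R := trunc_dist (@dD R).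

Lemma rJ1_ge0 a b : 0 <= rJ1 a b.
Proof. exact/trunc_dist_ge0/dJ1_ge0. Qed.
Lemma rJ1_le1 a b : rJ1 a b <= 1.
Proof. exact/trunc_dist_le1/dJ1_ge0. Qed.
Lemma rJ1_refl a : rJ1 a a = 0.
Proof. exact/trunc_dist_refl/dJ1_refl. Qed.
Lemma rJ1_sym a b : rJ1 a b = rJ1 b a.
Proof. exact/trunc_dist_sym/dJ1_sym. Qed.
Lemma rJ1_triangle b a c : rJ1 a c <= rJ1 a b + rJ1 b c.
Proof. exact: (trunc_dist_triangle (@dJ1_ge0 R) (@dJ1_triangle R)). Qed.

Lemma rD_ge0 x y : 0 <= rD x y.
Proof. exact/trunc_dist_ge0/dD_ge0. Qed.
Lemma rD_le1 x y : rD x y <= 1.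
Proof. exact/trunc_dist_le1/dD_ge0. Qed.
Lemma rD_refl x : rD x x = 0.
Proof. exact/trunc_dist_refl/dD_refl. Qed.
Lemma rD_sym x y : rD x y = rD y x.
Proof. exact/trunc_dist_sym/dD_sym. Qed.
Lemma rD_triangle y x z : rD x z <= rD x y + rD y z.
Proof. exact: (trunc_dist_triangle (@dD_ge0 R) (@dD_triangle R)). Qed.

Lemma nbhs_rJ1P (a : D R) (U : set (D R)) :
  nbhs a U <-> exists2 e, 0 < e & forall b, rJ1 a b < e -> U b.
Proof. by rewrite -nbhs_ballE; exact/dist_ball_trunc/dJ1_ge0. Qed.

Lemma nbhs_rDP (a : DD R) (U : set (DD R)) :
  nbhs a U <-> exists2 e, 0 < e & forall b, rD a b < e -> U b.
Proof. by rewrite -nbhs_ballE; exact/dist_ball_trunc/dD_ge0. Qed.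

(** One time change bounds the distance from above; for e >= 1 the bound is the
    truncation itself. *)
Lemma rD_le (x y : DD R) (lam : I01 R -> I01 R) (e : R) : Lambda lam ->
  (forall t, `|tm (lam t) - tm t| <= e) ->
  (forall t, rJ1 (x t) (y (lam t)) <= e) -> rD x y <= e.
Proof.
move=> Ll le1 le2; have [e1|e1] := leP 1 e.
  by apply: le_trans e1; exact: rD_le1.
rewrite trunc_dist_le//; last exact: dD_ge0.
apply: (@le_trans _ _ (maxe (id_norm lam)
  (ereal_sup [set dJ1 (x t) (y (lam t)) | t in [set: I01 R]]))).
  by apply: ereal_inf_lbound; exists lam.
rewrite ge_max; apply/andP; split; apply: ge_ereal_sup => _ [t _ <-].
  by rewrite lee_fin; exact: le1.
by rewrite -trunc_dist_le//; exact: dJ1_ge0.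
Qed.

(** Conversely, a small distance is witnessed by a time change: the truncation
    is invisible below 1. *)
Lemma rD_ltP (x y : DD R) (e : R) : e <= 1 -> rD x y < e ->
  exists lam : I01 R -> I01 R, [/\ Lambda lam,
   forall t, `|tm (lam t) - tm t| < e & forall t, rJ1 (x t) (y (lam t)) < e].
Proof.
move=> e1; rewrite trunc_dist_lt//; last exact: dD_ge0.
move=> /ereal_inf_lt [_ [l Ll <-]]; rewrite gt_max => /andP[l1 l2].
exists l; split => // t.
  rewrite -lte_fin; apply: le_lt_trans l1.
  by apply: ereal_sup_ubound; exists t.
rewrite trunc_dist_lt//; last exact: dJ1_ge0.
by apply: le_lt_trans l2; apply: ereal_sup_ubound; exists t.
Qed.

Lemma DD_right (x : DD R) (t : I01 R) (e : R) : 0 < e ->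
  exists2 r, 0 < r & forall s : I01 R, tm t <= tm s -> tm s < tm t + r ->
    rJ1 (x t) (x s) < e.
Proof.
move=> e0; have cr := (DD_cadlag x).1.
have [t1|t1] := ltP (tm t) 1; last first.
  exists 1 => // s ts _; suff -> : s = t by rewrite rJ1_refl.
  apply: tm_inj; apply/eqP; rewrite eq_le ts andbT.
  by rewrite (le_trans (tm_le1 _)).
have nU : nbhs (x t) [set b | rJ1 (x t) b < e] by apply/nbhs_rJ1P; exists e.
have /= := cr t t1 _ nU.
move=> [/= r r0 rU]; exists r => // s.
rewrite le_eqVlt => /orP[/eqP/tm_inj <- _|ts str]; first by rewrite rJ1_refl.
have := rU (tm s); rewrite /= tmK; apply => //.
by rewrite ltr_distlC; apply/andP; rewrite -/(tm t); split; lra.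
Qed.

(** The Cauchy form of the existence of a left limit. *)
Lemma DD_left (x : DD R) (t : I01 R) (e : R) : 0 < e ->
  exists2 r, 0 < r & forall s s' : I01 R, tm t - r < tm s -> tm s < tm t ->
    tm t - r < tm s' -> tm s' < tm t -> rJ1 (x s) (x s') < e.
Proof.
move=> e0; have cl := (DD_cadlag x).2.
have [t0|t0] := ltP 0 (tm t); last first.
  exists 1 => // s s' _ st; suff : tm s < 0 by rewrite ltNge tm_ge0.
  exact: (lt_le_trans st t0).
have [l lx] := cl t t0.
have nU : nbhs l [set b | rJ1 l b < e / 2].
  by apply/nbhs_rJ1P; exists (e / 2) => //; rewrite divr_gt0.
have /= := lx _ nU.
move=> [/= r r0 rU]; exists r => // s s' ts st ts' st'.
have h u : tm t - r < tm u -> tm u < tm t -> rJ1 l (x u) < e / 2.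
  move=> tu ut; have := rU (tm u); rewrite /= tmK; apply => //.
  by rewrite ltr_distlC; apply/andP; rewrite -/(tm t); split; lra.
have := h _ ts st; have := h _ ts' st'.
have := rJ1_triangle l (x s) (x s'); rewrite (rJ1_sym (x s) l); lra.
Qed.

End real_metrics.

(** * Piecewise linear time changes *)
Section cells.
Context {R : realType}.
Implicit Types (w p q : nat -> R) (K : nat).

(** The index i < K with w i <= r < w i.+1 when w increases, and K when
    w K <= r. *)
Definition cell K w (r : R) : nat := (\sum_(i < K) (w i.+1 <= r)%R)%N.

Lemma incr_ltn K w : (forall i, (i < K)%N -> w i < w i.+1) ->
  forall i j, (i < j <= K)%N -> w i < w j.
Proof.
move=> winc i; elim=> [//|j IHj] /andP[]; rewrite ltnS leq_eqVlt.
case/orP => [/eqP <- iK|ij jK]; first exact: winc.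
by apply: lt_trans (winc _ jK); rewrite IHj// ij ltnW.
Qed.

Lemma incr_leq K w : (forall i, (i < K)%N -> w i < w i.+1) ->
  forall i j, (i <= j <= K)%N -> w i <= w j.
Proof.
move=> winc i j /andP[]; rewrite leq_eqVlt => /orP[/eqP -> //|ij jK].
by apply/ltW/(incr_ltn winc); rewrite ij.
Qed.

Lemma cellE K w j r : (forall i, (i < K)%N -> w i < w i.+1) ->
  (j < K)%N -> w j <= r < w j.+1 -> cell K w r = j.
Proof.
move=> winc jK /andP[wjr rwj]; rewrite /cell.
rewrite -(big_mkord xpredT (fun i => (w i.+1 <= r)%R : nat)).
rewrite (@big_cat_nat _ _ _ j)//=; last exact: ltnW.
rewrite big_nat (eq_bigr (fun=> 1%N)); last first.
  move=> i /andP[_ ij]; apply/eqP; rewrite eqb1; apply: le_trans wjr.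
  by apply: (incr_leq winc); rewrite ij ltnW.
rewrite -big_nat sum_nat_const_nat subn0 muln1 big_nat big1 ?addn0//.
move=> i /andP[ji iK]; apply/eqP; rewrite eqb0 -ltNge (lt_le_trans rwj)//.
by apply: (incr_leq winc); rewrite iK andbT ltnS.
Qed.

Lemma cellK K w r : (forall i, (i < K)%N -> w i < w i.+1) ->
  w K <= r -> cell K w r = K.
Proof.
move=> winc wr; rewrite /cell (eq_bigr (fun=> 1%N)) ?sum1_card ?card_ord//.
move=> i _; apply/eqP; rewrite eqb1; apply: le_trans wr.
by apply: (incr_leq winc); rewrite leqnn ltn_ord.
Qed.

Lemma ex_cell_co K w r : w 0%N <= r < w K ->
  exists2 i, (i < K)%N & w i <= r < w i.+1.
Proof.
elim: K => [|K IHK] /andP[w0 wK].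
  by move: (le_lt_trans w0 wK); rewrite ltxx.
have [wr|wr] := ltP r (w K); last by exists K => //; rewrite wr.
by have [|i iK iw] := IHK; [rewrite w0|exists i => //; exact: ltnW].
Qed.

Lemma ex_cell_oc K w r : w 0%N < r <= w K ->
  exists2 i, (i < K)%N & w i < r <= w i.+1.
Proof.
elim: K => [|K IHK] /andP[w0 wK].
  by move: (lt_le_trans w0 wK); rewrite ltxx.
have [wr|wr] := leP r (w K); last by exists K => //; rewrite wr.
by have [|i iK iw] := IHK; [rewrite w0|exists i => //; exact: ltnW].
Qed.

(** The piecewise linear interpolation of p i |-> q i.  Only its effect on
    the cells is recorded, since DD is metrized with the uniform norm of time
    changes, which depends on positions rather than slopes. *)
Lemma Lambda_nodes K p q : (forall i, (i < K)%N -> p i < p i.+1) ->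
    (forall i, (i < K)%N -> q i < q i.+1) ->
    p 0%N = 0 -> p K = 1 -> q 0%N = 0 -> q K = 1 ->
  exists2 lam : I01 R -> I01 R, Lambda lam &
    [/\ forall s, tm s = 1 -> tm (lam s) = 1 &
     forall i s, (i < K)%N -> p i <= tm s < p i.+1 ->
       q i <= tm (lam s) < q i.+1].
Proof.
move=> pinc qinc p0 pK q0 qK.
pose L r := let j := cell K p r in
  q j + (q j.+1 - q j) * ((r - p j) / (p j.+1 - p j)).
have L1 : L 1 = 1.
  by rewrite /L cellK// ?pK// subrr mul0r mulr0 addr0.
have LE i r : (i < K)%N -> p i <= r < p i.+1 ->
    L r = q i + (q i.+1 - q i) * ((r - p i) / (p i.+1 - p i)).
  by move=> iK ir; rewrite /L (cellE pinc iK ir).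
have Lcell i r : (i < K)%N -> p i <= r < p i.+1 -> q i <= L r < q i.+1.
  move=> iK /[dup] ir /andP[pir rpi]; rewrite (LE _ _ iK ir).
  have dp : 0 < p i.+1 - p i by rewrite subr_gt0 pinc.
  have dq : 0 < q i.+1 - q i by rewrite subr_gt0 qinc.
  set z := _ / _.
  have z0 : 0 <= z by apply: divr_ge0; [rewrite subr_ge0|exact: ltW].
  have z1 : z < 1 by rewrite ltr_pdivrMr// mul1r ltrD2r.
  by apply/andP; split; nra.
have cell01 r : 0 <= r -> r <= 1 -> r = 1 \/
    exists2 i, (i < K)%N & p i <= r < p i.+1.
  move=> r0; rewrite le_eqVlt => /orP[/eqP ->|r1]; [by left|right].
  by apply: ex_cell_co; rewrite p0 pK r0.
have qge0 i : (i <= K)%N -> 0 <= q i.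
  by move=> iK; rewrite -q0; apply: (incr_leq qinc).
have qle1 i : (i <= K)%N -> q i <= 1.
  by move=> iK; rewrite -qK; apply: (incr_leq qinc); rewrite iK leqnn.
have L01 r : 0 <= r -> r <= 1 -> 0 <= L r <= 1.
  move=> r0 r1; have [->|[i iK ir]] := cell01 r r0 r1.
    by rewrite L1 ler01 lexx.
  have /andP[h1 h2] := Lcell i r iK ir.
  by rewrite (le_trans _ h1) ?qge0 ?(ltnW iK)//= (le_trans (ltW h2))// qle1.
have Lmono r r' : 0 <= r -> r < r' -> r' <= 1 -> L r < L r'.
  move=> r0 rr' r'1; have r1 := lt_le_trans rr' r'1.
  have [e|[i iK ir]] := cell01 r r0 (ltW r1); first by rewrite e ltxx in r1.
  have /andP[h1 h2] := Lcell i r iK ir.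
  have [->|[j jK jr]] := cell01 r' (le_trans r0 (ltW rr')) r'1.
    by rewrite L1; apply: (lt_le_trans h2); exact: qle1.
  have /andP[h3 h4] := Lcell j r' jK jr.
  have [ij|ji|eij] := ltngtP i j.
  - apply: (lt_le_trans h2); apply: le_trans h3.
    by apply: (incr_leq qinc); rewrite ij ltnW.
  - have : p j.+1 <= p i by apply: (incr_leq pinc); rewrite ji ltnW.
    by move: ir jr => /andP[? ?] /andP[? ?]; lra.
  - rewrite (LE _ _ iK ir) eij (LE _ _ jK jr) ltrD2l ltr_pM2l ?subr_gt0 ?qinc//.
    by rewrite ltr_pM2r ?invr_gt0 ?subr_gt0 ?pinc// ltrD2r.
have Lsurj v : 0 <= v -> v <= 1 -> exists2 r, 0 <= r <= 1 & L r = v.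
  move=> v0; rewrite le_eqVlt => /orP[/eqP ->|v1].
    by exists 1; rewrite ?ler01 ?lexx.
  have [|i iK /andP[qiv vqi]] := @ex_cell_co K q v; first by rewrite q0 qK v0.
  have dp : 0 < p i.+1 - p i by rewrite subr_gt0 pinc.
  have dq : 0 < q i.+1 - q i by rewrite subr_gt0 qinc.
  pose z := (v - q i) / (q i.+1 - q i).
  have z0 : 0 <= z by apply: divr_ge0; [rewrite subr_ge0|exact: ltW].
  have z1 : z < 1 by rewrite ltr_pdivrMr// mul1r ltrD2r.
  have rP : p i <= p i + z * (p i.+1 - p i) < p i.+1 by apply/andP; split; nra.
  exists (p i + z * (p i.+1 - p i)).
    move: rP => /andP[r1 r2]; apply/andP; split.
      by apply: le_trans r1; rewrite -p0; apply: (incr_leq pinc);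
        rewrite leq0n ltnW.
    apply: (le_trans (ltW r2)); rewrite -pK.
    by apply: (incr_leq pinc); rewrite iK leqnn.
  rewrite (LE _ _ iK rP) addrAC subrr add0r mulfK ?gt_eqF//.
  by rewrite mulrC divfK ?gt_eqF// addrC subrK.
pose lam s := pt01 (L (tm s)).
have lamE s : tm (lam s) = L (tm s).
  by rewrite pt01_tm// L01 ?tm_ge0 ?tm_le1.
have lam_incr (s t : I01 R) : \val s < \val t -> \val (lam s) < \val (lam t).
  move=> st; change (tm (lam s) < tm (lam t)).
  by rewrite !lamE; apply: Lmono; [exact: tm_ge0|exact: st|exact: tm_le1].
have lam_onto t : exists s, lam s = t.
  have [r r01 Lr] := Lsurj (tm t) (tm_ge0 t) (tm_le1 t).
  by exists (pt01 r); rewrite /lam pt01_tm// Lr tmK.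
exists lam.
  by split => //; exact: incr_onto_continuous.
split => [s s1|i s iK ps]; first by rewrite lamE s1 L1.
by rewrite lamE; exact: Lcell.
Qed.

End cells.

(** * Sampling a path on a grid *)
Section step_functions.
Context {R : realType}.

Definition is_grid K (u : nat -> I01 R) : Prop :=
  [/\ tm (u 0%N) = 0, tm (u K) = 1 &
      forall i, (i < K)%N -> tm (u i) < tm (u i.+1)].

Variables (K : nat) (u : nat -> I01 R).
Hypothesis uK : is_grid K u.

(** At time 1 the cell index is K, so the last value is used at 1 only; this
    allows the sampled path to keep a jump of the path at 1. *)
Definition step_fun (a : 'I_K.+1 -> D R) (t : I01 R) : D R :=
  a (inord (cell K (tm \o u) (tm t))).

Let u_incr : forall i, (i < K)%N -> (tm \o u) i < (tm \o u) i.+1.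
Proof. by case: uK. Qed.

Lemma step_fun_cell a i t : (i < K)%N -> tm (u i) <= tm t < tm (u i.+1) ->
  step_fun a t = a (inord i).
Proof. by move=> iK it; rewrite /step_fun (cellE u_incr iK it). Qed.

Lemma step_fun1 a t : tm t = 1 -> step_fun a t = a (inord K).
Proof. by move=> t1; rewrite /step_fun cellK//= t1; case: uK => _ ->. Qed.

Lemma step_fun_cadlag a : cadlag (step_fun a).
Proof.
have [u0 u1 _] := uK; split => t tlt.
  have [|i iK] := @ex_cell_co _ K (tm \o u) (tm t).
    by rewrite /= u0 u1 tm_ge0; exact: tlt.
  move=> /[dup] it /andP[/= it1 it2]; apply: cvg_near_cst.
  near=> r; rewrite (step_fun_cell _ iK it); apply: step_fun_cell => //.
  have tr : tm t < r by near: r; exact: nbhs_right_gt.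
  have ri : r < tm (u i.+1) by near: r; exact: nbhs_right_lt.
  rewrite pt01_tm ?ri ?(le_trans it1 (ltW tr))//.
  by rewrite (le_trans (tm_ge0 t) (ltW tr)) (le_trans (ltW ri) (tm_le1 _)).
have [|i iK /andP[/= it1 it2]] := @ex_cell_oc _ K (tm \o u) (tm t).
  by rewrite /= u0 u1 tm_le1 andbT; exact: tlt.
exists (a (inord i)); apply: cvg_near_cst.
near=> r; apply: step_fun_cell => //.
have rt : r < tm t by near: r; exact: nbhs_left_lt.
have ir : tm (u i) < r by near: r; exact: nbhs_left_gt.
rewrite pt01_tm ?(ltW ir) ?(lt_le_trans rt it2)//.
by rewrite (le_trans (tm_ge0 _) (ltW ir)) (le_trans (ltW rt) (tm_le1 _)).
Unshelve. all: by end_near. Qed.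

Definition step (a : Dpow R K.+1) : DD R := MkDD (step_fun_cadlag a).

(** The identity time change compares two step functions on the same grid,
    so the map from values to step functions is a contraction; continuity
    follows and transfers weak convergence from finite-dimensional
    distributions to sampled paths. *)
Lemma rD_step_le a b e : (forall i, rJ1 (a i) (b i) <= e) ->
  rD (step a) (step b) <= e.
Proof.
move=> ab; have e0 : 0 <= e by apply: le_trans (ab ord0); exact: rJ1_ge0.
apply: (rD_le (lam := id)); first exact: Lambda_id.
  by move=> t; rewrite subrr normr0.
by move=> t; exact: ab.
Qed.

Lemma step_continuous : continuous step.
Proof.
move=> a U /nbhs_rDP[e e0 eU].
have e2 : 0 < e / 2 by rewrite divr_gt0.
have ab : nbhs a [set b : Dpow R K.+1 | forall i, rJ1 (a i) (b i) < e / 2].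
  apply: (@filter_forall _ 'I_K.+1 (fun i b => rJ1 (a i) (b i) < e / 2)
    (nbhs a) (nbhs_filter a)) => i.
  have ai : nbhs (a i) [set c | rJ1 (a i) c < e / 2].
    by apply/nbhs_rJ1P; exists (e / 2).
  exact: (@proj_continuous _ (fun=> D R) i a _ ai).
suff abU : [set b | forall i, rJ1 (a i) (b i) < e / 2] `<=` step @^-1` U.
  exact: (@filterS _ (nbhs a) (nbhs_filter a) _ _ abU ab).
move=> b /= ab'; apply: eU; apply: (@le_lt_trans _ _ (e / 2)).
  by apply: rD_step_le => i; apply/ltW.
by rewrite ltr_pdivrMr// ltr_pMr// ltr1n.
Qed.

(** Written through projs, so that the law of a sampled path is an image of a
    finite-dimensional distribution. *)
Definition sample (x : DD R) : DD R := step (projs (fun i : 'I_K.+1 => u i) x).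

Lemma sampleE (x : DD R) i t : (i < K)%N -> tm (u i) <= tm t < tm (u i.+1) ->
  sample x t = x (u i).
Proof.
move=> iK it; rewrite /sample/= (step_fun_cell _ iK it).
by rewrite /projs/proj inordK// ltnW.
Qed.

Lemma sample1 (x : DD R) t : tm t = 1 -> sample x t = x t.
Proof.
move=> t1; rewrite /sample/= step_fun1// /projs/proj inordK//.
by congr (x _); apply: tm_inj; rewrite t1; case: uK.
Qed.

(** If x stays close to x (u i) on [p i, p i.+1[, the time change that moves
    p i to u i aligns x with its sampled path.  The nodes satisfy
    u i < p i.+1 <= u i.+1, so they move by less than two meshes. *)
Lemma rD_sample_le (x : DD R) (p : nat -> R) (h e : R) :
    (forall i, (i < K)%N -> tm (u i.+1) - tm (u i) <= h) ->
    p 0%N = 0 -> p K = 1 ->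
    (forall i, (i < K)%N -> tm (u i) < p i.+1 <= tm (u i.+1)) ->
    (forall i s, (i < K)%N -> p i <= tm s < p i.+1 ->
       rJ1 (x s) (x (u i)) <= e) ->
  0 <= h -> 0 <= e -> rD x (sample x) <= h *+ 2 + e.
Proof.
move=> uh p0 pK pu xe h0 e0; have [u0 u1 _] := uK.
have pinc i : (i < K)%N -> p i < p i.+1.
  case: i => [|i] iK; last first.
    have /andP[_ h1] := pu i (ltnW iK); have /andP[h2 _] := pu _ iK.
    exact: le_lt_trans h1 h2.
  by rewrite p0 -u0; have /andP[] := pu _ iK.
have [lam Ll [lam1 lamE]] := Lambda_nodes pinc u_incr p0 pK u0 u1.
have s01 s : tm s = 1 \/ exists2 i, (i < K)%N & p i <= tm s < p i.+1.
  have := tm_le1 s; rewrite le_eqVlt => /orP[/eqP ->|s1]; [by left|right].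
  by apply: ex_cell_co; rewrite p0 pK tm_ge0.
apply: (rD_le Ll) => s.
  have [s1|[i iK is_]] := s01 s.
    by rewrite (lam1 _ s1) s1 subrr normr0 addr_ge0// mulrn_wge0.
  have /andP[/= l1 l2] := lamE _ _ iK is_.
  move: is_ => /andP[is1 is2]; have /andP[_ pi1] := pu _ iK.
  have := uh _ iK.
  have : tm (u i) - h <= p i.
    case: i iK {l1 l2 is1 is2 pi1} => [|i] iK; first by rewrite u0 p0; lra.
    by have /andP[+ _] := pu i (ltnW iK); have := uh i (ltnW iK); lra.
  by rewrite ler_distl; move=> *; apply/andP; split; lra.
have [s1|[i iK is_]] := s01 s.
  have -> : lam s = s by apply: tm_inj; rewrite s1; exact: lam1.
  by rewrite sample1// rJ1_refl addr_ge0// mulrn_wge0.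
rewrite (sampleE _ iK (lamE _ _ iK is_)).
by apply: (le_trans (xe _ _ iK is_)); rewrite lerDr mulrn_wge0.
Qed.

End step_functions.

Section sampling_error.
Context {R : realType}.
Variables (k : nat) (u : nat -> I01 R).
Hypothesis uK : is_grid k.+1 u.

(** It is enough that in each cell x switches at most once from the value at the
    left end to the value at the right end: the switching points serve as
    nodes.  The last cell is special, because a time change fixes 1 and the
    switching point of that cell cannot be moved there; x must stay close to
    x (u k) up to time 1. *)
Lemma rD_sample_le_switch (x : DD R) (h e : R) :
    (forall i, (i < k.+1)%N -> tm (u i.+1) - tm (u i) <= h) ->
    (forall i, (i < k)%N -> exists c : R, [/\ tm (u i) < c <= tm (u i.+1),
       forall s, tm (u i) <= tm s < c -> rJ1 (x s) (x (u i)) <= e &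
       forall s, c <= tm s <= tm (u i.+1) -> rJ1 (x s) (x (u i.+1)) <= e]) ->
    (forall s, tm (u k) <= tm s < 1 -> rJ1 (x s) (x (u k)) <= e) ->
  0 <= h -> 0 <= e -> rD x (sample uK x) <= h *+ 2 + e.
Proof.
move=> uh xc xe h0 e0; have [u0 u1 uinc] := uK.
have /choice[c cP] : forall i, exists c : R, (i < k)%N ->
    [/\ tm (u i) < c <= tm (u i.+1),
       forall s, tm (u i) <= tm s < c -> rJ1 (x s) (x (u i)) <= e &
       forall s, c <= tm s <= tm (u i.+1) -> rJ1 (x s) (x (u i.+1)) <= e].
  move=> i; have [ik|ik] := ltnP i k; last by exists 0.
  by have [c cP] := xc i ik; exists c.
pose p i := if i is j.+1 then if (j < k)%N then c j else 1 else 0.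
apply: (@rD_sample_le _ _ _ uK x p) => //.
- by rewrite /p ltnn.
- move=> i; rewrite ltnS leq_eqVlt => /orP[/eqP ->|ik].
    by rewrite /p ltnn u1 lexx andbT -u1 uinc.
  by rewrite /p ik; have [] := cP _ ik.
- move=> i s ik /andP[is1 is2]; have [si|is_] := ltP (tm s) (tm (u i)).
    case: i ik is1 is2 si => [|i] ik is1 is2 si.
      by move: si; rewrite u0 ltNge tm_ge0.
    have [_ _ cR] := cP _ ik; apply: cR.
    by rewrite (ltW si) andbT; move: is1; rewrite /p -ltnS ik.
  move: ik; rewrite ltnS leq_eqVlt => /orP[/eqP ik|ik].
    by move: is_ is2; rewrite ik /p ltnn => is_ is2; apply: xe; rewrite is_.
  by have [_ cL _] := cP _ ik; apply: cL; rewrite is_; move: is2; rewrite /p ik.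
Qed.

End sampling_error.

(** * Sampling error from the modulus *)
Section modulus_control.
Context {R : realType}.
Implicit Types (x : DD R).

Lemma w2D_lt x (delta e : R) (t1 t t2 : I01 R) : (w2D x delta < e%:E)%E ->
  tm t1 <= tm t -> tm t <= tm t2 -> tm t2 - tm t1 <= delta ->
  rJ1 (x t) (x t1) < e \/ rJ1 (x t2) (x t) < e.
Proof.
move=> xe h1 h2 h3.
have : (mine (dJ1 (x t) (x t1)) (dJ1 (x t2) (x t)) < e%:E)%E.
  by apply: le_lt_trans xe; apply: ereal_sup_ubound; exists t1, t, t2.
rewrite gt_min => /orP[h|h]; [left|right]; rewrite -lte_fin;
  apply: le_lt_trans h; exact/trunc_dist_le_dist/dJ1_ge0.
Qed.

(** A small modulus allows a single large move in a short interval [a, b].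
    The switching point is the first time c at which x is at distance e from
    x a.  After any s1 with rJ1 (x a) (x s1) >= e, both the triple a, s1, b and
    the triple a, s1, s force the second alternative in the modulus, so x s and
    x b are both close to x s1.  At c itself right-continuity is used; it also
    yields a < c. *)
Lemma w2D_switch x (delta e : R) (a b : I01 R) : (w2D x delta < e%:E)%E ->
  0 < e -> tm a < tm b -> tm b - tm a <= delta ->
  exists c : R, [/\ tm a < c <= tm b,
     forall s, tm a <= tm s < c -> rJ1 (x s) (x a) <= e *+ 2 &
     forall s, c <= tm s <= tm b -> rJ1 (x s) (x b) <= e *+ 2].
Proof.
move=> xe e0 ab abd.
pose S := [set tm s | s in [set s | [/\ tm a <= tm s, tm s <= tm b &
                                     e <= rJ1 (x a) (x s)]]].
have [[s0 [as0 s0b es0]]|noS] := pselect (exists s, [/\ tm a <= tm s,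
    tm s <= tm b & e <= rJ1 (x a) (x s)]); last first.
  exists (tm b); split; first by rewrite ab lexx.
    move=> s /andP[as_ sb]; have [es|es] := leP e (rJ1 (x a) (x s)).
      by exfalso; apply: noS; exists s; split => //; exact: ltW.
    by rewrite rJ1_sym; lra.
  move=> s; rewrite -eq_le => /eqP/tm_inj ->; rewrite rJ1_refl; lra.
have hS : has_inf S.
  split; first by exists (tm s0); exists s0.
  by exists (tm a) => _ [s [? _ _] <-].
have [r r0 ar] := DD_right x a e0.
have ac : tm a < inf S.
  apply: (@lt_le_trans _ _ (tm a + r)); first by rewrite ltrDl.
  apply: lb_le_inf; first by exists (tm s0); exists s0.
  move=> _ [s [as_ _ es] <-]; rewrite leNgt; apply/negP => sar.
  by have := ar s as_ sar; rewrite ltNge es.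
have cs s : tm a <= tm s -> tm s <= tm b -> e <= rJ1 (x a) (x s) ->
    inf S <= tm s.
  by move=> *; apply: ge_inf; [case: hS|exists s].
(* strictly after inf S some earlier point is already far from x a *)
have far s : inf S < tm s -> tm s <= tm b -> rJ1 (x s) (x b) < e *+ 2.
  move=> cs' sb; have [_ [s1 [as1 s1b es1] <-] s1s] := inf_lt hS.1 cs'.
  have [h|h1] := @w2D_lt x delta e a s1 b xe as1 s1b abd.
    by move: h; rewrite rJ1_sym ltNge es1.
  have [h|h2] := @w2D_lt x delta e a s1 s xe as1 (ltW s1s) ltac:(lra).
    by move: h; rewrite rJ1_sym ltNge es1.
  have := rJ1_triangle (x s1) (x s) (x b).
  by rewrite (rJ1_sym (x s1) (x b)); lra.
exists (inf S); split.
- by rewrite ac/= (le_trans (cs _ as0 s0b es0)).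
- move=> s /andP[as_ sc]; rewrite leNgt; apply/negP => h.
  have sb : tm s <= tm b.
    by apply/ltW/(lt_le_trans sc)/(le_trans (cs _ as0 s0b es0)).
  have : e <= rJ1 (x a) (x s) by rewrite rJ1_sym; lra.
  by move=> /(cs s as_ sb); rewrite leNgt sc.
- move=> s /andP[]; rewrite le_eqVlt => /orP[/eqP sc|cs'] sb; last first.
    exact/ltW/far.
  move: sb; rewrite le_eqVlt => /orP[/eqP/tm_inj ->|sb].
    by rewrite rJ1_refl mulrn_wge0// ltW.
  apply/ler_addgt0Pl => eta eta0.
  have [r' r'0 sr'] := DD_right x s eta0.
  pose m := Num.min (tm s + r' / 2) (tm b).
  have sm : tm s < m by rewrite lt_min sb andbT; lra.
  have m1 : m <= tm b by rewrite ge_min lexx orbT.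
  have tmm : tm (pt01 m) = m.
    rewrite pt01_tm// (le_trans m1 (tm_le1 _)).
    by rewrite (le_trans (tm_ge0 s) (ltW sm)).
  have m2 : m < tm s + r'.
    by apply: (@le_lt_trans _ _ (tm s + r' / 2)); [rewrite ge_min lexx|lra].
  have h1 := sr' (pt01 m); have h2 := far (pt01 m); rewrite !tmm in h1 h2.
  have := rJ1_triangle (x (pt01 m)) (x s) (x b).
  have := h1 (ltW sm) m2; have := h2 _ m1; rewrite -sc in sm *.
  by move=> /(_ sm); lra.
Qed.

(** In the last cell the modulus only says that x s is close to x (u k) or to
    x 1, which is why the distance between these two values enters. *)
Lemma rD_sample_w2D k u (uK : is_grid k.+1 u) x (h delta e : R) :
    (forall i, (i < k.+1)%N -> tm (u i.+1) - tm (u i) <= h) -> h <= delta ->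
    (w2D x delta < e%:E)%E -> 0 < e ->
  rD x (sample uK x) <= h *+ 2 + e *+ 2 + rJ1 (x (u k)) (x (pt01 1)).
Proof.
move=> uh hd xe e0; have [u0 u1 uinc] := uK.
have h0 : 0 <= h by apply: le_trans (uh 0%N isT); rewrite subr_ge0 ltW// uinc.
rewrite -addrA; have j0 := rJ1_ge0 (x (u k)) (x (pt01 1)).
apply: rD_sample_le_switch => //; last by lra.
- move=> i ik; have ik1 : (i < k.+1)%N by exact: ltnW.
  have [c [c1 c2 c3]] := w2D_switch xe e0 (uinc i ik1) (le_trans (uh i ik1) hd).
  by exists c; split => // s sc; [have := c2 s sc|have := c3 s sc]; lra.
- move=> s /andP[us s1].
  have := @w2D_lt x delta e (u k) s (pt01 1) xe us; rewrite tm1.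
  have hk : 1 - tm (u k) <= delta by rewrite -u1 (le_trans (uh k _)).
  move=> /(_ (ltW s1) hk) [|]; first by lra.
  have := rJ1_triangle (x (pt01 1)) (x s) (x (u k)).
  rewrite (rJ1_sym (x s) (x (pt01 1))) (rJ1_sym (x (pt01 1)) (x (u k))); lra.
Qed.

End modulus_control.

(** * Regularity of a single path *)
Section cadlag_windows.
Context {R : realType}.
Implicit Types (x : DD R).

(** Near a given time t, one-sided limits provide a switching point: t itself
    when a < t <= b, and b when [a, b] lies on one side of t.  Compactness of
    [0, 1] makes the admissible length of [a, b] uniform. *)
Lemma DD_switch x (e : R) : 0 < e -> exists2 delta, 0 < delta &
  forall a b : I01 R, tm a < tm b -> tm b - tm a <= delta ->
  exists c : R, [/\ tm a < c <= tm b,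
     forall s, tm a <= tm s < c -> rJ1 (x s) (x a) <= e &
     forall s, c <= tm s <= tm b -> rJ1 (x s) (x b) <= e].
Proof.
move=> e0; have e20 : 0 < e / 2 by rewrite divr_gt0.
have /compact_near_coveringP nc := @segment_compact R 0 1.
pose Q (d r : R) := forall a b : I01 R, tm a = r -> tm a < tm b ->
  tm b - tm a <= d ->
  exists c : R, [/\ tm a < c <= tm b,
     forall s, tm a <= tm s < c -> rJ1 (x s) (x a) <= e &
     forall s, c <= tm s <= tm b -> rJ1 (x s) (x b) <= e].
have : \forall d \near 0^'+, `[0, 1] `<=` Q d.
  apply: (nc R (0^'+) Q) => r /=; rewrite in_itv/= => r01.
  have tr := pt01_tm r01; set t := pt01 r in tr.
  have [r1 r10 xr] := DD_right x t e20; have [r2 r20 xl] := DD_left x t e0.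
  have m0 : 0 < Num.min r1 r2 / 2 by rewrite divr_gt0// lt_min r10.
  have mr1 : Num.min r1 r2 <= r1 by rewrite ge_min lexx.
  have mr2 : Num.min r1 r2 <= r2 by rewrite ge_min lexx orbT.
  exists (ball r (Num.min r1 r2 / 2), [set d | d < Num.min r1 r2 / 2]) => /=.
    by split; [exact: nbhsx_ballx|exact: nbhs_right_lt].
  move=> [r' d] /= [rr' dm] a b ar ab abd.
  move: rr'; rewrite /ball/= -ar -tr ltr_distl => /andP[ra1 ra2].
  have [ta|at_] := leP (tm t) (tm a).
    exists (tm b); split; first by rewrite ab lexx.
      move=> s /andP[as_ sb]; have := xr a ta ltac:(lra).
      have := xr s ltac:(lra) ltac:(lra).
      have := rJ1_triangle (x t) (x s) (x a).
      by rewrite (rJ1_sym (x s) (x t)); lra.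
    by move=> s; rewrite -eq_le => /eqP/tm_inj ->; rewrite rJ1_refl ltW.
  have [tb|bt] := leP (tm t) (tm b).
    exists (tm t); split; first by rewrite at_.
      by move=> s /andP[as_ st]; apply/ltW/xl; lra.
    move=> s /andP[ts sb]; have := xr b tb ltac:(lra).
    have := xr s ts ltac:(lra).
    have := rJ1_triangle (x t) (x s) (x b).
    by rewrite (rJ1_sym (x s) (x t)); lra.
  exists (tm b); split; first by rewrite ab lexx.
    by move=> s /andP[as_ sb]; apply/ltW/xl; lra.
  by move=> s; rewrite -eq_le => /eqP/tm_inj ->; rewrite rJ1_refl ltW.
move=> [/= d d0 dQ]; exists (d / 2); first by rewrite divr_gt0.
move=> a b ab abd; have : Q (d / 2) (tm a).
  apply: dQ; rewrite /= ?in_itv/= ?tm_ge0 ?tm_le1//; last by rewrite divr_gt0.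
  by rewrite sub0r normrN gtr0_norm ?divr_gt0//; lra.
exact.
Qed.

(** Sampled paths converge to the path as the mesh vanishes.  The bound in the
    last cell comes from the left limit at 1, and a jump at 1 is reproduced
    exactly because sampling keeps the value at 1. *)
Lemma rD_sample_small x (e : R) : 0 < e -> exists2 delta, 0 < delta &
  forall k u (uK : is_grid k.+1 u),
    (forall i, (i < k.+1)%N -> tm (u i.+1) - tm (u i) <= delta) ->
  rD x (sample uK x) <= e.
Proof.
move=> e0; have e20 : 0 < e / 2 by rewrite divr_gt0.
have [d d0 xd] := DD_switch x e20; have [r r0 xr] := DD_left x (pt01 1) e20.
pose h := Num.min (Num.min d (r / 2)) (e / 4).
have h0 : 0 < h by rewrite !lt_min d0 !divr_gt0.
have hd : h <= d by rewrite !ge_min lexx.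
have hr : h <= r / 2 by rewrite !ge_min lexx !orbT.
have he : h <= e / 4 by rewrite !ge_min lexx !orbT.
exists h => // k u uK uh; have [u0 u1 uinc] := uK.
apply: (@le_trans _ _ (h *+ 2 + e / 2)); last by lra.
apply: rD_sample_le_switch => //; try exact: ltW.
  move=> i ik; have ik1 : (i < k.+1)%N by exact: ltnW.
  by apply: xd; [exact: uinc|exact: le_trans (uh i ik1) hd].
move=> s /andP[us s1]; have := uh k (ltnSn k); rewrite u1 => hk.
by apply/ltW/xr; rewrite ?tm1; have := uinc k (ltnSn k); rewrite ?u1; lra.
Qed.

(** Up to the boundary case of equality: the left limit at t is at distance more
    than e from x t. *)
Definition jump x (e : R) (t : I01 R) : Prop := forall r, 0 < r ->
  exists s, [/\ tm t - r < tm s, tm s < tm t & e < rJ1 (x s) (x t)].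

(** In an interval short enough for a single switching point, a jump can
    only occur at that point; finitely many such intervals cover ]0, 1]. *)
Lemma finite_jumps x (e : R) : 0 < e -> finite_set [set t | jump x e t].
Proof.
move=> e0; have e20 : 0 < e / 2 by rewrite divr_gt0.
have [d d0 xd] := DD_switch x e20.
have [N dN] : exists N : nat, N.+1%:R^-1 < d.
  exists (Num.truncn d^-1); rewrite invf_plt ?posrE ?ltr0n//.
  by apply: truncnS_gt.
pose w (i : nat) : R := i%:R / N.+1%:R.
have wS i : w i.+1 - w i = N.+1%:R^-1.
  by rewrite /w -mulrBl -natrB ?leqnSn// subSnn mul1r.
have w01 i : (i <= N.+1)%N -> 0 <= w i <= 1.
  by move=> iN; rewrite divr_ge0//= ler_pdivrMr// mul1r ler_nat.
have tw i : (i <= N.+1)%N -> tm (pt01 (w i)) = w i by move=> /w01/pt01_tm.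
have /choice[c cP] : forall i, exists c : R, (i < N.+1)%N ->
    [/\ w i < c <= w i.+1,
     forall s, w i <= tm s < c -> rJ1 (x s) (x (pt01 (w i))) <= e / 2 &
     forall s, c <= tm s <= w i.+1 -> rJ1 (x s) (x (pt01 (w i.+1))) <= e / 2].
  move=> i; have [iN|iN] := ltnP i N.+1; last by exists 0.
  have := xd (pt01 (w i)) (pt01 (w i.+1)); rewrite !tw// 1?ltnW// wS.
  have iS : w i < w i.+1 by rewrite -subr_gt0 wS invr_gt0.
  by move=> /(_ iS (ltW dN)) [c cP]; exists c.
apply: (@sub_finite_set _ _ [set pt01 (c i) | i in `I_N.+1]); last first.
  exact/finite_image/finite_II.
move=> t jt; have [s0 [_ s0t _]] := jt 1 ltr01.
have [|i iN /andP[it ti]] := @ex_cell_oc _ N.+1 w (tm t).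
  rewrite {1}/w mul0r /w divff ?pnatr_eq0// tm_le1 andbT.
  exact: le_lt_trans (tm_ge0 _) s0t.
have [/andP[c1 c2] cL cR] := cP i iN.
exists i => //; apply: tm_inj; rewrite pt01_tm; last first.
  have /andP[h1 _] := w01 i (ltnW iN); have /andP[_ h2] := w01 _ iN.
  by rewrite (le_trans h1 (ltW c1)) (le_trans c2 h2).
have [ct|tc|->//] := ltgtP (c i) (tm t).
  have [s [s1 s2]] := jt (tm t - c i) ltac:(lra).
  have := cR s ltac:(lra); have := cR t ltac:(lra).
  have := rJ1_triangle (x (pt01 (w i.+1))) (x s) (x t).
  by rewrite (rJ1_sym (x (pt01 _)) (x t)); lra.
have [s [s1 s2]] := jt (tm t - w i) ltac:(lra).
have := cL s ltac:(lra); have := cL t ltac:(lra).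
have := rJ1_triangle (x (pt01 (w i))) (x s) (x t).
by rewrite (rJ1_sym (x (pt01 _)) (x t)); lra.
Qed.

(** A path close to x in DD takes at t a value that x nearly takes at some
    time s close to t, and without a jump at t the value x s is close to x t. *)
Lemma proj_cont_at t x : (forall e, 0 < e -> ~ jump x e t) ->
  {for x, continuous (@Defs.proj R t)}.
Proof.
move=> xt U /nbhs_rJ1P[e e0 eU]; apply/nbhs_rDP.
pose e' := Num.min e 1.
have e'0 : 0 < e' by rewrite lt_min e0 ltr01.
have e'e : e' <= e by rewrite ge_min lexx.
have e'1 : e' <= 1 by rewrite ge_min lexx orbT.
have e'2 : 0 < e' / 2 by rewrite divr_gt0.
have [r1 r10 xl] : exists2 r, 0 < r & forall s, tm t - r < tm s ->
    tm s < tm t -> rJ1 (x s) (x t) <= e' / 2.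
  apply: contrapT => h; apply: (xt _ e'2) => r r0; apply: contrapT => h'.
  apply: h; exists r => // s h1 h2; rewrite leNgt; apply/negP => h3.
  by apply: h'; exists s.
have [r2 r20 xr] := DD_right x t e'2.
pose r := Num.min (Num.min r1 r2) (e' / 2).
have r0 : 0 < r by rewrite !lt_min r10 r20.
have rr1 : r <= r1 by rewrite !ge_min lexx.
have rr2 : r <= r2 by rewrite !ge_min lexx !orbT.
have re : r <= e' / 2 by rewrite !ge_min lexx !orbT.
exists r => // y xy; apply: eU; apply: lt_le_trans e'e.
have r1le : r <= 1 by lra.
have [lam [Ll l1 l2]] := rD_ltP r1le xy.
have [_ _ lo] := Ll; have [s st] := lo t.
have := l2 s; rewrite st; have := l1 s; rewrite st ltr_distl => /andP[h1 h2].
have : rJ1 (x s) (x t) <= e' / 2.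
  have [ts|st'] := leP (tm t) (tm s).
    by rewrite rJ1_sym; apply/ltW/xr => //; lra.
  by apply: xl => //; lra.
have := rJ1_triangle (x s) (x t) (y t).
by rewrite /Defs.proj (rJ1_sym (x t) (x s)); lra.
Qed.

Lemma proj_cont_end t : tm t = 0 \/ tm t = 1 -> continuous (@Defs.proj R t).
Proof.
move=> t01 x U /nbhs_rJ1P[e e0 eU]; apply/nbhs_rDP.
exists (Num.min e 1); first by rewrite lt_min e0 ltr01.
have m1 : Num.min e 1 <= 1 by rewrite ge_min lexx orbT.
move=> y /(rD_ltP m1)[lam [[_ li lo] _ /(_ t)]] xy; apply: eU.
apply: (@lt_le_trans _ _ (Num.min e 1)); last by rewrite ge_min lexx.
suff lt : lam t = t by rewrite lt in xy.
have [s st] := lo t; have [ts|st'|/tm_inj ts] := ltgtP (tm t) (tm s).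
- have h : tm (lam t) < tm (lam s) := li _ _ ts; rewrite st in h.
  case: t01 => e1; rewrite e1 in h ts; last by move: ts; rewrite ltNge tm_le1.
  by move: h; rewrite ltNge tm_ge0.
- have h : tm (lam s) < tm (lam t) := li _ _ st'; rewrite st in h.
  case: t01 => e1; rewrite e1 in h st'.
    by move: st'; rewrite ltNge tm_ge0.
  by move: h; rewrite ltNge tm_le1.
- by rewrite ts st.
Qed.

End cadlag_windows.

(** * Measurability of the evaluations *)
Section measurability_of_evaluations.
Context {R : realType}.

Lemma nbhs_DpowP k (a : Dpow R k) (U : set (Dpow R k)) :
  nbhs a U <->
  exists2 e, 0 < e & forall b, (forall i, rJ1 (a i) (b i) < e) -> U b.
Proof.
split=> [aU|[e e0 eU]]; last first.
  have ab : nbhs a [set b : Dpow R k | forall i, rJ1 (a i) (b i) < e].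
    apply: (@filter_forall _ 'I_k (fun i b => rJ1 (a i) (b i) < e)
      (nbhs a) (nbhs_filter a)) => i.
    have ai : nbhs (a i) [set c | rJ1 (a i) c < e].
      by apply/nbhs_rJ1P; exists e.
    exact: (@proj_continuous _ (fun=> D R) i a _ ai).
  exact: (@filterS _ (nbhs a) (nbhs_filter a) _ _ eU ab).
pose F := [set V : set (Dpow R k) | exists2 e, 0 < e &
  forall b, (forall i, rJ1 (a i) (b i) < e) -> V b].
have FF : Filter F.
  split.
  - by exists 1.
  - move=> V W [e e0 eV] [e' e'0 e'W]; exists (Num.min e e').
      by rewrite lt_min e0 e'0.
    move=> b ab; split; [apply: eV|apply: e'W] => i;
      apply: (lt_le_trans (ab i)).
      by rewrite ge_min lexx.
    by rewrite ge_min lexx orbT.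
  - by move=> V W VW [e e0 eV]; exists e => // b /eV/VW.
suff : cvg_to F (nbhs (a : {ptws 'I_k -> D R})) by apply; exact: aU.
apply/cvg_sup => i V; rewrite nbhsE => -[B [[W oW <-] /= Wa] BV].
have /nbhs_rJ1P[e e0 eW] : nbhs (a i) W by exact: open_nbhs_nbhs.
by exists e => // b ab; apply: BV; exact/eW/ab.
Qed.

(** Evaluation at t is not continuous, but by right-continuity x t lies in an
    open set U as soon as x s lies well inside U for all s slightly larger
    than t, and conversely.  The latter condition is closed in DD, since a small
    time change moves s only slightly; so the preimage of U is a countable
    union of closed sets.  At a time equal to 1 no larger s exists, and s = 1 is
    used, which every time change fixes.  The argument treats finitely
    many times at once. *)
Lemma measurable_evals k (t : 'I_k -> I01 R) :
  measurable_fun [set: borel (DD R)] (projs t).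
Proof.
apply: (@measurability _ _ (borel (DD R)) (borel (Dpow R k)) setT (projs t)
  (@open (Dpow R k)) erefl) => _ [U oU <-]; rewrite setTI.
pose close (r : R) (i : 'I_k) (s : I01 R) :=
  (tm (t i) < tm s /\ tm s < tm (t i) + r) \/ (tm (t i) = 1 /\ s = t i).
pose O (q : R) := [set x : DD R | exists (s : 'I_k -> I01 R) (b : Dpow R k),
  [/\ forall i, close q i (s i),
     forall i, rJ1 (x (s i)) (b i) < q & ~ U b]].
have oO q : open (O q).
  rewrite openE => x [s [b [st xb nUb]]]; rewrite /interior.
  apply/nbhs_rDP.
  (* r is a radius below the slack in each of the strict inequalities *)
  have [r /= [r0 [r1 rP]]] : exists r : R, 0 < r /\ r <= 1 /\ forall i,
      r <= q - rJ1 (x (s i)) (b i) /\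
      (tm (t i) < tm (s i) -> r <= tm (s i) - tm (t i) /\
         (tm (s i) < tm (t i) + q ->
          r <= tm (t i) + q - tm (s i))).
    have : \forall r \near 0^'+, forall i : 'I_k,
      r <= q - rJ1 (x (s i)) (b i) /\
      (tm (t i) < tm (s i) -> r <= tm (s i) - tm (t i) /\
         (tm (s i) < tm (t i) + q ->
          r <= tm (t i) + q - tm (s i))).
      apply: filter_forall => i.
      have h0 : 0 < q - rJ1 (x (s i)) (b i) by rewrite subr_gt0.
      have [h|h] := ltP (tm (t i)) (tm (s i)); last first.
        by near=> r; split=> //; near: r; exact: nbhs_right_le.
      have h1 : 0 < tm (s i) - tm (t i) by rewrite subr_gt0.
      have [h'|h'] := ltP (tm (s i)) (tm (t i) + q); last first.
        by near=> r; split; last (move=> _; split=> //);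
          near: r; exact: nbhs_right_le.
      have h2 : 0 < tm (t i) + q - tm (s i) by rewrite subr_gt0.
      by near=> r; split; last (move=> _; split; last move=> _);
        near: r; exact: nbhs_right_le.
    move=> rP; near (0 : R)^'+ => r; exists r; split; last split.
    - by near: r; exact: nbhs_right_gt.
    - by near: r; exact: nbhs_right_le.
    - by near: r; exact: rP.
  exists r => // y /(rD_ltP r1)[lam [Ll l1 l2]].
  exists (lam \o s), b; split => // i /=.
    have := l1 (s i); rewrite ltr_distl => /andP[h1 h2].
    have [_ ri] := rP i.
    have [[h3 h4]|[h3 h4]] := st i; [left|right].
      by have [h5 /(_ h4) h6] := ri h3; split; lra.
    split => //; rewrite h4; apply: tm_inj.
    have [_ li lo] := Ll; have [z zt] := lo (t i).
    have [e|] := eqVneq z (t i); first by rewrite -e zt e.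
    move=> zt'; have : tm z < tm (t i).
      rewrite lt_neqAle {2}h3 tm_le1 andbT.
      by apply: contra zt' => /eqP/tm_inj/eqP.
    move=> /(li _ _); rewrite zt => /lt_le_trans /(_ (tm_le1 (lam (t i)))).
    by rewrite -/(tm _) h3 ltxx.
  have [ri _] := rP i; have := l2 (s i).
  have := rJ1_triangle (x (s i)) (y (lam (s i))) (b i).
  by rewrite (rJ1_sym (y (lam (s i))) (x (s i))); lra.
have -> : projs t @^-1` U = \bigcup_n ~` (O n.+1%:R^-1).
  apply/seteqP; split=> [x Ux|x [n _ nOx]].
    have /nbhs_DpowP[e e0 eU] : nbhs (projs t x : Dpow R k) U.
      exact: open_nbhs_nbhs.
    have e20 : 0 < e / 2 by rewrite divr_gt0.
    have : \forall n \near \oo, forall i : 'I_k, forall s,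
        close n.+1%:R^-1 i s -> rJ1 (x (t i)) (x s) < e / 2.
      apply: filter_forall => i; have [r r0 xr] := DD_right x (t i) e20.
      near=> n; move=> s [[h1 h2]|[_ ->]]; last by rewrite rJ1_refl.
      apply: xr; first exact: ltW.
      apply: (lt_trans h2); rewrite ltrD2l.
      by near: n; exact: (near_infty_natSinv_lt (PosNum r0)).
    move=> H.
    have [n [ne nP]] : exists n : nat, n.+1%:R^-1 < e / 2 /\ forall i : 'I_k,
        forall s, close n.+1%:R^-1 i s -> rJ1 (x (t i)) (x s) < e / 2.
      near \oo => n; exists n; split; last by near: n.
      by near: n; exact: (near_infty_natSinv_lt (PosNum e20)).
    exists n => // -[s [b [st xb nUb]]]; apply: nUb; apply: eU => i.
    have := nP i _ (st i); have := lt_trans (xb i) ne.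
    have := rJ1_triangle (x (s i)) (x (t i)) (b i).
    by rewrite /projs/Defs.proj; lra.
  apply: contrapT => nUx; apply: nOx.
  have n0 : 0 < n.+1%:R^-1 :> R by rewrite invr_gt0.
  move: (n.+1%:R^-1 : R) n0 => q q0.
  have /choice[s sP] : forall i, exists s, close q i s /\
      rJ1 (x s) (x (t i)) < q.
    move=> i; have [r r0 xr] := DD_right x (t i) q0.
    have := tm_le1 (t i); rewrite le_eqVlt => /orP[/eqP t1|t1].
      by exists (t i); rewrite rJ1_refl; split => //; right.
    pose m := Num.min (Num.min r q) (1 - tm (t i)) / 2.
    have m0 : 0 < m by rewrite divr_gt0// !lt_min r0 q0 subr_gt0.
    have mr : m * 2 <= r by rewrite divfK// !ge_min lexx.
    have mn : m * 2 <= q by rewrite divfK// !ge_min lexx !orbT.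
    have m1 : m * 2 <= 1 - tm (t i) by rewrite divfK// !ge_min lexx !orbT.
    have t0 := tm_ge0 (t i).
    have tmm : tm (pt01 (tm (t i) + m)) = tm (t i) + m.
      by rewrite pt01_tm//; apply/andP; split; lra.
    exists (pt01 (tm (t i) + m)); rewrite /close tmm; split; first by left; lra.
    by rewrite rJ1_sym; apply: xr; rewrite tmm; lra.
  by exists s, (projs t x); split => // i; have [] := sP i.
apply: bigcup_measurable => n _; apply: measurableC.
exact: sub_sigma_algebra.
Unshelve. all: by end_near. Qed.

End measurability_of_evaluations.

(** * Times of almost sure continuity *)
Section borel_functions.
Context {R : realType}.

Lemma continuous_measurable_borel (T : ptopologicalType) (f : T -> R) :
  continuous f -> measurable_fun [set: borel T] f.
Proof.
move=> /continuousP cf.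
apply: (@measurability _ _ (borel T) _ setT f _
  (measurable_realfun.RGenOpens.measurableE R)).
move=> _ [_ [a [b -> <-]]]; rewrite setTI; apply: sub_sigma_algebra.
by apply: cf; exact: interval_open.
Qed.

Lemma rJ1_coord_continuous k (i j : 'I_k) :
  continuous (fun a : Dpow R k => rJ1 (a i) (a j)).
Proof.
move=> a U /nbhs_ballP[e /= e0 eU].
have e20 : 0 < e / 2 by rewrite divr_gt0.
apply/nbhs_DpowP; exists (e / 2) => // b ab; apply: eU.
rewrite /ball/= ltr_distl; have := ab i; have := ab j.
have := rJ1_triangle (b i) (a i) (a j); have := rJ1_triangle (b j) (b i) (a j).
have := rJ1_triangle (a i) (b i) (b j); have := rJ1_triangle (a j) (a i) (b j).
rewrite (rJ1_sym (b j) (a j)) (rJ1_sym (b i) (a i)).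
by move=> *; apply/andP; split; lra.
Qed.

Lemma measurable_rJ1_evals (s t : I01 R) :
  measurable_fun [set: borel (DD R)] (fun x : DD R => rJ1 (x s) (x t)).
Proof.
pose u (i : 'I_2) := if i == ord0 then s else t.
have -> : (fun x : DD R => rJ1 (x s) (x t)) =
  (fun a : Dpow R 2 => rJ1 (a ord0) (a ord_max)) \o projs u by [].
apply: measurableT_comp; last exact: measurable_evals.
apply: (@continuous_measurable_borel (Dpow R 2)).
exact: rJ1_coord_continuous.
Qed.

End borel_functions.

Section continuity_times.
Context {R : realType} (P : probability (borel (DD R)) R).

(** A fixed sequence increasing to t detects the jumps at t, so that
    the event of a jump at t is measurable. *)
Let below (t : I01 R) (j : nat) : I01 R := pt01 (tm t - tm t / j.+1%:R).

Let tm_below t j : tm (below t j) = tm t - tm t / j.+1%:R.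
Proof.
have t0 := tm_ge0 t; have t1 := tm_le1 t.
have j0 : 0 <= tm t / j.+1%:R by rewrite divr_ge0.
have jt : tm t / j.+1%:R <= tm t by rewrite ler_pdivrMr// ler_peMr// ler1n.
rewrite pt01_tm//; move: (tm t / _) j0 jt => q j0 jt.
by apply/andP; split; lra.
Qed.

Let J (e : R) (t : I01 R) : set (borel (DD R)) :=
  lim_sup_set (fun j => [set x : DD R | e < rJ1 (x (below t j)) (x t)]).

Let measurable_gap e t j :
  measurable ([set x : DD R | e < rJ1 (x (below t j)) (x t)] :
    set (borel (DD R))).
Proof.
have mf := measurable_rJ1_evals (below t j) t.
have := mf measurableT _ (measurable_itv `]e, +oo[); rewrite setTI.
rewrite (_ : _ @^-1` _ = [set x : DD R | e < rJ1 (x (below t j)) (x t)])//.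
by apply/seteqP; split=> x /=; rewrite in_itv/= andbT.
Qed.

Let measurable_J e t : measurable (J e t).
Proof.
apply: bigcap_measurable => // n _; apply: bigcup_measurable => k _.
exact: measurable_gap.
Qed.

Let J_jump e t x : 0 < e -> J e t x -> jump x e t.
Proof.
move=> e0 Jx r r0.
have [n nr] : exists n : nat, n.+1%:R^-1 < r.
  near \oo => n; exists n; near: n; exact: (near_infty_natSinv_lt (PosNum r0)).
have [j /= nj xj] := Jx n I.
have t0 : 0 < tm t.
  rewrite lt_neqAle tm_ge0 andbT; apply/eqP => t0.
  move: xj; suff -> : below t j = t by rewrite rJ1_refl ltNge ltW.
  by apply: tm_inj; rewrite tm_below -t0 mul0r subr0.
exists (below t j); split=> //; rewrite tm_below; last first.
  by rewrite gtrBl divr_gt0.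
rewrite ltrD2l ltrN2; apply: le_lt_trans nr.
apply: (@le_trans _ _ j.+1%:R^-1).
  by rewrite ler_piMl ?invr_ge0// tm_le1.
by rewrite lef_pV2 ?posrE// ler_nat.
Unshelve. all: by end_near. Qed.

Let jump_J e t x : 0 < e -> jump x (e *+ 2) t -> J e t x.
Proof.
move=> e0 xj n _; have [r r0 xr] := DD_left x t e0.
have [s [s1 s2 s3]] := xj r r0.
have t0 : 0 < tm t by exact: le_lt_trans (tm_ge0 s) s2.
near \oo => j; exists j => /=.
  by near: j; exact: nbhs_infty_ge.
have h1 : tm (below t j) < tm t by rewrite tm_below gtrBl divr_gt0.
have h2 : tm t - r < tm (below t j).
  rewrite tm_below ltrD2l ltrN2; apply: (@le_lt_trans _ _ j.+1%:R^-1).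
    by rewrite ler_piMl ?invr_ge0// tm_le1.
  near: j; exact: (near_infty_natSinv_lt (PosNum r0)).
have := xr s (below t j) s1 s2 h2 h1.
by have := rJ1_triangle (x (below t j)) (x s) (x t); lra.
Unshelve. all: by end_near. Qed.

(** If infinitely many times each carried a jump above e with probability
    above q, then with probability at least q infinitely many of these jumps
    would occur simultaneously, while a path has only finitely many. *)
Lemma finite_likely_jumps (e q : R) : 0 < e -> 0 < q ->
  finite_set [set t | (q%:E < P (J e t))%E].
Proof.
move=> e0 q0; apply: contrapT => /infiniteP/card_leP[f0].
pose f (n : nat) : I01 R := \val (f0 (exist _ n (mem_set I))).
have f_inj : injective f.
  move=> m n /val_inj /('inj_f0 (mem_set I) (mem_set I)).
  by move=> /(congr1 \val).
pose F n := J e (f n).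
have mF n : measurable (F n) by exact: measurable_J.
have qF n : (q%:E < P (F n))%E.
  by have /set_mem := valP (f0 (exist _ n (mem_set I))).
have qS : (q%:E <= P (lim_sup_set F))%E.
  have Foo : (P (\bigcup_(k >= 0) F k) < +oo)%E.
    apply: le_lt_trans (ltry 1); apply: probability_le1.
    exact: bigcup_measurable.
  have cv := lim_sup_set_cvg P F mF Foo.
  rewrite -(cvg_lim _ cv)//; apply: lime_ge; first exact: (cvgP _ cv).
  apply: nearW => n; apply: (le_trans (ltW (qF n))); apply: le_measure.
  - by rewrite inE.
  - by rewrite inE; apply: bigcup_measurable.
  - by move=> x Fx; exists n => /=.
have [x Sx] : lim_sup_set F !=set0.
  apply/set0P/eqP => S0; move: qS; rewrite S0 measure0 lee_fin.
  by rewrite leNgt q0.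
have : finite_set (f @^-1` [set t | jump x e t]).
  by apply: finite_preimage; [move=> m n _ _; exact: f_inj|exact: finite_jumps].
move=> /finite_seqP[s sE].
have [n /= ns /(J_jump e0) xn] := Sx (\max_(i <- s) i).+1 I.
have : (n \in s) by move: (xn : (f @^-1` [set t | jump x e t]) n); rewrite sE.
by move=> /(@leq_bigmax_seq _ s xpredT id n) /(_ isT); rewrite leqNgt ns.
Qed.

(** At a time outside TP some jump size 1 / (m + 1) has probability above some
    1 / (n + 1), and for each m and n there are finitely many such times. *)
Lemma countable_not_TP : countable (~` TP P).
Proof.
pose E (n : nat) : R := n.+1%:R^-1.
have E0 n : 0 < E n by rewrite invr_gt0.
apply: (@sub_countable _ _ _ (\bigcup_(m in setT) \bigcup_(n in setT)
    [set t | ((E n)%:E < P (J (E m) t))%E])); last first.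
  apply: bigcup_countable => // m _; apply: bigcup_countable => // n _.
  exact/finite_set_countable/finite_likely_jumps.
apply: subset_card_le => t; apply: contra_notP => nt.
have P0 m : P (J (E m) t) = 0%E.
  apply/eqP; rewrite eq_le measure_ge0 andbT leNgt; apply/negP => Pm.
  apply: nt; exists m => //.
  have fm : P (J (E m) t) \is a fin_num by apply: fin_num_measure.
  have fm0 : 0 < fine (P (J (E m) t)) by rewrite -lte_fin fineK.
  near \oo => n; exists n => //=; rewrite -[X in (_ < X)%E]fineK// lte_fin.
  by near: n; exact: (near_infty_natSinv_lt (PosNum fm0)).
have mJ : measurable (\bigcup_m J (E m) t) by exact: bigcup_measurable.
exists (\bigcup_m J (E m) t); split => //.
  apply/negligibleP => //; apply: negligible_bigcup => m.
  by apply/negligibleP; [exact: measurable_J|exact: P0].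
move=> x; apply: contra_notP => nJ; apply: proj_cont_at => e e0 xe.
have e20 : 0 < e / 2 by rewrite divr_gt0.
apply: nJ; near \oo => m.
have me : E m < e / 2 by near: m; exact: (near_infty_natSinv_lt (PosNum e20)).
exists m => //; apply: jump_J => //.
move=> r r0; have [s [s1 s2 s3]] := xe r r0; exists s; split => //.
by apply: le_lt_trans s3; lra.
Unshelve. all: by end_near. Qed.

Lemma TP_dense (a b : R) : 0 <= a -> a < b -> b <= 1 ->
  exists2 t, TP P t & a < tm t < b.
Proof.
move=> a0 ab b1; apply: contrapT => h.
have : (lebesgue_measure `]a, b[%classic = 0 :> \bar R)%E.
  apply: countable_lebesgue_measure0.
  apply: (@sub_countable _ _ _ (tm @` (~` TP P))); last first.
    exact: sub_countable (card_image_le _ _) countable_not_TP.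
  apply: subset_card_le => r; rewrite /= in_itv/= => /andP[ar rb].
  have tr : tm (pt01 r) = r by rewrite pt01_tm// !ltW//; lra.
  exists (pt01 r) => // tP; apply: h; exists (pt01 r) => //.
  by rewrite tr ar.
rewrite lebesgue_measure_itv/= lte_fin ab -EFinD => -[]; lra.
Qed.

Lemma TP_end t : tm t = 0 \/ tm t = 1 -> TP P t.
Proof. by move=> t01; apply: aeW => x; exact: proj_cont_end. Qed.

End continuity_times.

(** * Expectations of bounded functions *)
Section expectations.
Context d (T : measurableType d) (R : realType) (P : probability T R).
Implicit Types f g : T -> R.

Definition bounded_rv f := measurable_fun setT f /\
  exists M : R, forall x, `|f x| <= M.

Lemma bounded_rv_integrable f : bounded_rv f -> P.-integrable setT (EFin \o f).
Proof.
move=> [mf [M fM]]; apply: measurable_bounded_integrable => //.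
  by apply: le_lt_trans (ltry 1); exact: probability_le1.
exists M; split; first exact: num_real.
by move=> N MN x _; apply: le_trans (fM x) (ltW MN).
Qed.

Lemma bounded_rv_integralE f : bounded_rv f ->
  (\int[P]_x (f x)%:E)%E = (\int[P]_x f x)%:E.
Proof.
move=> /bounded_rv_integrable fi; rewrite /Rintegral fineK//.
exact: integrable_fin_num.
Qed.

Lemma bounded_rvB f g : bounded_rv f -> bounded_rv g -> bounded_rv (f \- g).
Proof.
move=> [mf [M fM]] [mg [N gN]]; split; first exact: measurable_funB.
by exists (M + N) => x /=; apply: le_trans (ler_normB _ _) (lerD _ _).
Qed.

Lemma bounded_rv_opp f : bounded_rv f ->
  \int[P]_x (- f x) = - \int[P]_x f x.
Proof.
move=> bf; under eq_Rintegral do rewrite -mulN1r.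
by rewrite RintegralZl ?mulN1r//; exact: bounded_rv_integrable.
Qed.

Lemma bounded_rv_le f g : bounded_rv f -> bounded_rv g ->
  (forall x, f x <= g x) -> \int[P]_x f x <= \int[P]_x g x.
Proof.
by move=> bf bg fg; apply: le_Rintegral => //; exact: bounded_rv_integrable.
Qed.

(** The indicator of B stands for an exceptional event on which only a crude
    bound is available; g carries the part of the error that is small only on
    average. *)
Lemma bounded_rv_dist_le f f' g (a c b : R) (B : set T) :
  bounded_rv f -> bounded_rv f' -> bounded_rv g -> measurable B ->
  (forall x, `|f x - f' x| <= a + c * g x + b * \1_B x) ->
  `|\int[P]_x f x - \int[P]_x f' x| <= a + c * \int[P]_x g x + b * fine (P B).
Proof.
move=> bf bf' bg mB fg.
have fi := bounded_rv_integrable bf; have fi' := bounded_rv_integrable bf'.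
have gi := bounded_rv_integrable bg.
have b1 : bounded_rv (\1_B : T -> R).
  split; [exact: measurable_indic|exists 1 => x; rewrite indicE].
  by case: (x \in B); rewrite ?normr1 ?normr0.
have ba : bounded_rv (fun=> a : R) by split => //; exists `|a|.
have bD h h' : bounded_rv h -> bounded_rv h' ->
    bounded_rv (fun x => h x + h' x).
  move=> [mh [M hM]] [mh' [N hN]]; split; first exact: measurable_funD.
  by exists (M + N) => x /=; apply: le_trans (ler_normD _ _) (lerD _ _).
have bZ z h : bounded_rv h -> bounded_rv (fun x => z * h x).
  move=> [mh [M hM]]; split; first exact: measurable_funM.
  by exists (`|z| * M) => x /=; rewrite normrM ler_wpM2l.
have bI := bounded_rv_integrable.
rewrite -RintegralB//; apply: le_trans (le_normr_Rintegral _ _) _ => //.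
  by apply: (bI (f \- f')); exact: bounded_rvB.
have -> : a + c * \int[P]_x g x + b * fine (P B) =
    \int[P]_x (a + c * g x + b * \1_B x).
  rewrite RintegralD//; last 2 first.
  - by apply: (bI (fun x => a + c * g x)); apply: bD => //; exact: bZ.
  - by apply: (bI (fun x => b * \1_B x)); exact: bZ.
  rewrite RintegralD//; last 2 first.
  - exact: (bI (fun=> a)).
  - by apply: (bI (fun x => c * g x)); exact: bZ.
  rewrite !RintegralZl//; last exact: (bI _ b1).
  have PT : fine (P setT) = 1 by rewrite (probability_setT P).
  rewrite Rintegral_cst//; rewrite PT mulr1; congr (_ + _ + _ * _).
  by rewrite /Rintegral integral_indic// setIT.
apply: le_Rintegral => //.
  have -> : (fun x => `|f x - f' x|) = Num.norm \o (f \- f') by [].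
  apply: bI; have [m1 [M hM]] := bounded_rvB bf bf'.
  split; first exact: measurableT_comp.
  by exists M => x /=; rewrite normr_id; exact: hM.
apply: bI; apply: (bD (fun x => a + c * g x) (fun x => b * \1_B x)).
  by apply: (bD (fun=> a) (fun x => c * g x)) => //; exact: bZ.
exact: bZ.
Qed.

(** Modulus events need not be measurable; a cover replaces them in
    integrals. *)
Lemma outer_cover (A : set T) (q : R) : (mu_ext P A < q%:E)%E ->
  exists B, [/\ measurable B, A `<=` B & fine (P B) < q].
Proof.
move=> /ereal_inf_lt[_ [F [mF AF] <-] Fq].
have mB : measurable (\bigcup_k F k) by exact: bigcup_measurable.
exists (\bigcup_k F k); split => //.
rewrite -lte_fin fineK; last by exact: fin_num_measure.
by apply: le_lt_trans Fq; exact: measure_sigma_subadditive.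
Qed.

Lemma bounded_rv_cvg (f_ : nat -> T -> R) f (M : R) :
  (forall n, measurable_fun setT (f_ n)) -> (forall n x, `|f_ n x| <= M) ->
  (forall x, f_ n x @[n --> \oo] --> f x) -> bounded_rv f ->
  \int[P]_x f_ n x @[n --> \oo] --> \int[P]_x f x.
Proof.
move=> mf fM cf bf.
have bn n : bounded_rv (f_ n) by split; [exact: mf|exists M].
have h : (\int[P]_x (f_ n x)%:E)%E @[n --> \oo] --> (\int[P]_x (f x)%:E)%E.
  apply: (@dominated_cvg _ _ _ P setT measurableT (fun n x => (f_ n x)%:E)
     (fun x => (f x)%:E) (fun=> M%:E)) => //.
  - by move=> n; apply/measurable_EFinP.
  - by move=> x _; apply: cvg_EFin; [exact: nearW|exact: cf].
  - apply: (bounded_rv_integrable (f := fun=> M)); split => //.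
    by exists `|M|.
  - by move=> n x _; rewrite lee_fin.
rewrite (bounded_rv_integralE bf) in h.
exact: (fine_cvg h).
Qed.

End expectations.

Lemma limn_esup_lt (R : realType) (u : (\bar R)^nat) (l : \bar R) :
  (limn_esup u < l)%E -> \forall n \near \oo, (u n < l)%E.
Proof.
move=> /ereal_inf_lt[_ [V nV <-] Vl]; apply: filterS nV => n Vn.
by apply: le_lt_trans Vl; apply: ereal_sup_ubound; exists n.
Qed.

(** * Grids of continuity times *)

Section grids.
Context {R : realType} (P : probability (borel (DD R)) R).

(** One point of TP is picked in each of the N + 1 intervals of length
    1 / (N + 1), and the two end points are added. *)
Lemma ex_TP_grid (N : nat) : exists u : nat -> I01 R,
  [/\ is_grid N.+2 u, forall i, TP P (u i) &
     forall i, (i < N.+2)%N -> tm (u i.+1) - tm (u i) <= 2 / N.+1%:R].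
Proof.
pose w (i : nat) : R := i%:R / N.+1%:R.
have wS i : w i.+1 = w i + N.+1%:R^-1 by rewrite /w -natr1 mulrDl mul1r.
have q0 : 0 < N.+1%:R^-1 :> R by rewrite invr_gt0.
have w1 : w N.+1 = 1 by rewrite /w divff ?pnatr_eq0.
have w0 : w 0%N = 0 by rewrite /w mul0r.
have /choice[v vP] : forall i, exists t, (i <= N)%N ->
    TP P t /\ w i < tm t < w i.+1.
  move=> i; have [iN|iN] := leqP i N; last by exists (pt01 0).
  have [||| t Tt tw] := @TP_dense _ P (w i) (w i.+1).
  - by rewrite divr_ge0.
  - by rewrite wS ltrDl.
  - by rewrite -w1 ler_pM2r// ler_nat.
  by exists t.
pose u i := if i is j.+1 then if (j <= N)%N then v j else pt01 1 else pt01 0.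
exists u; split.
- split; [exact: tm0|by rewrite /u ltnn tm1|].
  move=> [|i]; rewrite ltnS /u => iN /=.
    by rewrite tm0 -w0; have [_ /andP[]] := vP 0%N isT.
  have iN' : (i <= N)%N by []; rewrite iN'.
  have [_ /andP[h1 h2]] := vP _ iN'; case: ifPn => [h|].
    by have [_ /andP[h3 h4]] := vP _ h; exact: lt_trans h2 h3.
  rewrite -ltnNge ltnS => Ni; rewrite tm1 -w1.
  by rewrite (_ : N = i) //; apply/eqP; rewrite eqn_leq Ni.
- move=> [|i] /=; first by apply: TP_end; left; exact: tm0.
  by case: ifPn => [/vP[]//|_]; apply: TP_end; right; exact: tm1.
- move=> [|i]; rewrite ltnS /u => iN /=.
    have [_ /andP[_ h]] := vP 0%N isT; rewrite tm0 subr0 (le_trans (ltW h))//.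
    by rewrite wS w0 add0r ler_peMl ?(ltW q0)// ler1n.
  have iN' : (i <= N)%N by []; rewrite iN'.
  have [_ /andP[h1 h2]] := vP _ iN'; rewrite wS in h2.
  have e2 : 2 / N.+1%:R = N.+1%:R^-1 + N.+1%:R^-1 :> R.
    by rewrite mulr_natl mulr2n.
  case: ifPn => [h|].
    have [_ /andP[h3 h4]] := vP _ h; rewrite !wS in h4.
    by rewrite e2; move: (N.+1%:R^-1 : R) q0 h1 h4 => q *; lra.
  rewrite -ltnNge ltnS => Ni; rewrite tm1 e2.
  have : w i.+1 = 1.
    by rewrite -w1; congr (w _.+1); apply/eqP; rewrite eqn_leq Ni iN'.
  rewrite wS; move: (w i) (N.+1%:R^-1 : R) q0 h1 => z q *; lra.
Qed.

End grids.

(** * Reduction to Lipschitz test functions *)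
Section lipschitz_test_functions.
Context {R : realType}.
Implicit Types (f : DD R -> R).

Definition lipschitz_rD (L : R) f := forall x y, `|f x - f y| <= L * rD x y.

Lemma lipschitz_rD_continuous L f : 0 <= L -> lipschitz_rD L f -> continuous f.
Proof.
move=> L0 fL x U /nbhs_ballP[e /= e0 eU]; apply/nbhs_rDP.
have L1 : 0 < L + 1 by lra.
exists (e / (L + 1)); first by rewrite divr_gt0.
move=> y xy; apply: eU; rewrite /ball/=.
apply: (le_lt_trans (fL x y)); apply: (@le_lt_trans _ _ ((L + 1) * rD x y)).
  by rewrite ler_wpM2r ?rD_ge0//; lra.
by rewrite mulrC -ltr_pdivlMr.
Qed.

Lemma continuous_bounded_rv (T : ptopologicalType) (f : T -> R) (M : R) :
  continuous f -> (forall x, `|f x| <= M) -> bounded_rv (f : borel T -> R).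
Proof.
by move=> cf fM; split; [exact: continuous_measurable_borel|exists M].
Qed.

Section infimal_convolution.
Variables (f : DD R -> R) (M : R).
Hypothesis fM : forall x, `|f x| <= M.

(** The largest m-Lipschitz function below f. *)
Definition inf_conv (m : nat) (x : DD R) : R :=
  inf [set f y + m%:R * rD x y | y in [set: DD R]].

Let has_inf_conv m x : has_inf [set f y + m%:R * rD x y | y in [set: DD R]].
Proof.
split; first by exists (f x + m%:R * rD x x), x.
exists (- M) => _ [y _ <-]; have := fM y; rewrite ler_norml => /andP[h _].
by apply: (le_trans h); rewrite lerDl mulr_ge0// rD_ge0.
Qed.

Let inf_conv_lb m x y : inf_conv m x <= f y + m%:R * rD x y.
Proof. by apply: ge_inf; [case: (has_inf_conv m x)|exists y]. Qed.

Lemma inf_conv_le m x : inf_conv m x <= f x.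
Proof. by have := inf_conv_lb m x x; rewrite rD_refl mulr0 addr0. Qed.

Lemma inf_conv_bounded m x : `|inf_conv m x| <= M.
Proof.
rewrite ler_norml; apply/andP; split; last first.
  apply: (le_trans (inf_conv_le m x)).
  by have := fM x; rewrite ler_norml => /andP[].
apply: lb_le_inf; first by case: (has_inf_conv m x).
move=> _ [y _ <-]; have := fM y; rewrite ler_norml => /andP[h _].
by apply: (le_trans h); rewrite lerDl mulr_ge0// rD_ge0.
Qed.

Lemma inf_conv_lipschitz m : lipschitz_rD m%:R (inf_conv m).
Proof.
move=> x x'; rewrite ler_distl.
have h a b : inf_conv m a - m%:R * rD a b <= inf_conv m b.
  apply: lb_le_inf; first by case: (has_inf_conv m b).
  move=> _ [y _ <-]; rewrite lerBlDr; apply: (le_trans (inf_conv_lb m a y)).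
  rewrite -addrA lerD2l -mulrDr ler_wpM2l// addrC; exact: rD_triangle.
apply/andP; split.
  by rewrite rD_sym; exact: h.
by rewrite -lerBlDr; exact: h.
Qed.

Lemma inf_conv_cvg x : continuous f -> inf_conv m x @[m --> \oo] --> f x.
Proof.
move=> cf; apply/cvgrPdist_le => e e0.
have [r r0 rf] : exists2 r, 0 < r & forall y, rD x y < r -> `|f x - f y| < e.
  by apply/nbhs_rDP; exact: (cf x _ (nbhsx_ballx (f x) e e0)).
near=> m; rewrite ler_distl; have := inf_conv_le m x => h.
suff : f x - e <= inf_conv m x by move=> ?; apply/andP; split; lra.
apply: lb_le_inf; first by case: (has_inf_conv m x).
move=> _ [y _ <-]; have [xy|xy] := ltP (rD x y) r.
  have := rf y xy; rewrite ltr_distl => /andP[h1 h2].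
  have : 0 <= m%:R * rD x y by rewrite mulr_ge0// rD_ge0.
  by lra.
have h1 : 2 * M <= m%:R * rD x y.
  apply: (@le_trans _ _ (m%:R * r)); last by rewrite ler_wpM2l.
  rewrite -ler_pdivrMr//; near: m; exact: nbhs_infty_ger.
have := fM x; have := fM y; rewrite !ler_norml => /andP[h2 h3] /andP[h4 h5].
lra.
Unshelve. all: by end_near. Qed.

End infimal_convolution.

(** The Lipschitz minorants increase to f, so convergence for Lipschitz
    functions bounds the lower limit of the expectations of f from below by the
    expectation of f.  The same bound for - f gives the upper limit. *)
Lemma weak_cvg_lipschitz (P_ : nat -> probability (borel (DD R)) R)
    (P : probability (borel (DD R)) R) :
  (forall f L M, 0 <= L -> lipschitz_rD L f -> (forall x, `|f x| <= M) ->
    \int[P_ n]_x f x @[n --> \oo] --> \int[P]_x f x) ->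
  weak_cvg (DD R) P_ P.
Proof.
move=> lip f cf [M fM].
have brv (g : DD R -> R) : continuous g ->
    (forall x, `|g x| <= M) -> bounded_rv (g : borel (DD R) -> R).
  by move=> cg gM; exact: (@continuous_bounded_rv (DD R) g M).
have lower g : continuous g -> (forall x, `|g x| <= M) -> forall e, 0 < e ->
    \forall n \near \oo, \int[P]_x g x - e < \int[P_ n]_x g x.
  move=> cg gM e e0; have e20 : 0 < e / 2 by rewrite divr_gt0.
  have cm m : continuous (inf_conv g m).
    exact: (lipschitz_rD_continuous (ler0n _ m) (inf_conv_lipschitz gM m)).
  have bm := inf_conv_bounded gM.
  have : \int[P]_x inf_conv g m x @[m --> \oo] --> \int[P]_x g x.
    apply: (@bounded_rv_cvg _ _ _ P (inf_conv g) g M) => //.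
    - by move=> m; exact: (brv _ (cm m) (bm m)).1.
    - by move=> x; exact: (inf_conv_cvg gM).
    - exact: brv.
  move=> /cvgrPdist_lt/(_ _ e20)[m0 _ /(_ m0 (leqnn m0))] /= hm.
  have := lip _ _ _ (ler0n _ m0) (inf_conv_lipschitz gM m0) (bm m0).
  move=> /cvgrPdist_lt/(_ _ e20); apply: filterS => n hn.
  have : \int[P_ n]_x inf_conv g m0 x <= \int[P_ n]_x g x.
    apply: (@bounded_rv_le _ (borel (DD R)) R (P_ n)).
    - exact: (brv _ (cm m0) (bm m0)).
    - exact: (brv _ cg gM).
    - exact: (inf_conv_le gM).
  by move: hm hn; rewrite !ltr_distl => /andP[? ?] /andP[? ?]; lra.
rewrite (bounded_rv_integralE P (brv _ cf fM)).
under eq_fun do rewrite (bounded_rv_integralE _ (brv _ cf fM)).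
apply: cvg_EFin; first exact: nearW.
apply/cvgrPdist_lt => e e0.
have cN : continuous (fun x => - f x).
  by move=> x; apply: continuousN; exact: cf.
have NM x : `|- f x| <= M by rewrite normrN.
have := lower _ cN NM e e0; have := lower _ cf fM e e0.
apply: filterS2 => n h1.
rewrite !bounded_rv_opp; try exact: (brv _ cf fM).
by move=> h2; rewrite /= ltr_distl; apply/andP; split; lra.
Qed.

End lipschitz_test_functions.

(** * Weak convergence *)
Section convergence.
Context {R : realType} (P_ : nat -> probability (borel (DD R)) R)
    (P : probability (borel (DD R)) R).

Hypothesis fdd : forall (k : nat) (t : 'I_k -> I01 R), (0 < k)%N ->
  (forall i, TP P (t i)) ->
  weak_cvg (Dpow R k) (fun n => pushforward (P_ n) (projs t))
           (pushforward P (projs t)).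

Lemma fdd_expectation k (t : 'I_k -> I01 R) (g : Dpow R k -> R) (M : R) :
  (0 < k)%N -> (forall i, TP P (t i)) -> continuous g ->
  (forall a, `|g a| <= M) ->
  \int[P_ n]_x g (projs t x) @[n --> \oo] --> \int[P]_x g (projs t x).
Proof.
move=> k0 tT cg gM.
have bg (Q : probability (borel (DD R)) R) :
    bounded_rv (fun x : borel (DD R) => g (projs t x)).
  split; last by exists M.
  apply: (@measurableT_comp _ _ _ _ _ _ (g : borel (Dpow R k) -> R)).
    exact: continuous_measurable_borel.
  exact: measurable_evals.
have E (Q : probability (borel (DD R)) R) :
    (\int[pushforward Q (projs t)]_a (g a)%:E)%E = (\int[Q]_x g (projs t x))%:E.
  rewrite -(bounded_rv_integralE Q (bg Q)).
  rewrite (integral_pushforward (measurable_evals t) (f := EFin \o g)).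
  - by rewrite preimage_setT.
  - by apply/measurable_EFinP; exact: continuous_measurable_borel.
  - by rewrite preimage_setT; apply: (bounded_rv_integrable Q (bg Q)).
  - by [].
have := fdd k0 tT cg (ex_intro _ M gM); rewrite E.
under eq_fun do rewrite E.
exact: fine_cvg.
Qed.

End convergence.

Section sampling_expectations.
Context {R : realType}.
Implicit Types (Q : probability (borel (DD R)) R).

Lemma bounded_rv_rJ1 (s t : I01 R) :
  bounded_rv (fun x : borel (DD R) => rJ1 ((x : DD R) s) ((x : DD R) t)).
Proof.
split; first exact: measurable_rJ1_evals.
by exists 1 => x; rewrite ger0_norm ?rJ1_ge0 ?rJ1_le1.
Qed.

Lemma bounded_rv_sample K (u : nat -> I01 R) (uK : is_grid K u)
    (f : DD R -> R) (M : R) : continuous f -> (forall x, `|f x| <= M) ->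
  bounded_rv (fun x : borel (DD R) => f (sample uK x)).
Proof.
move=> cf fM; split; last by exists M.
apply: (@measurableT_comp _ _ _ (borel (DD R)) (borel (Dpow R K.+1)) R
  (fun a : borel (Dpow R K.+1) => f (step uK a))).
  apply: (@continuous_measurable_borel R (Dpow R K.+1)) => a.
  by apply: continuous_comp; [exact: step_continuous|exact: cf].
exact: measurable_evals.
Qed.

(** Off the event of a large modulus the sampling error is controlled by
    rD_sample_w2D; on that event the bound 2 M is used. *)
Lemma expectation_sample_dist Q k (u : nat -> I01 R) (uK : is_grid k.+1 u)
    (f : DD R -> R) (L M h delta e q : R) :
  0 <= L -> lipschitz_rD L f -> (forall x, `|f x| <= M) ->
  (forall i, (i < k.+1)%N -> tm (u i.+1) - tm (u i) <= h) -> h <= delta ->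
  0 < e ->
  (outer_prob Q [set x : DD R | (e%:E <= w2D x delta)%E] < q%:E)%E ->
  `|\int[Q]_x f x - \int[Q]_x f (sample uK x)| <=
    L * (h *+ 2 + e *+ 2) + L * \int[Q]_x rJ1 (x (u k)) (x (pt01 1)) +
    M *+ 2 * q.
Proof.
move=> L0 fL fM uh hd e0 /outer_cover[B [mB AB PB]].
have M0 : 0 <= M by apply: le_trans (fM (point : DD R)).
have cf := lipschitz_rD_continuous L0 fL.
have := @bounded_rv_dist_le _ _ _ Q f (fun x => f (sample uK x))
  (fun x => rJ1 (x (u k)) (x (pt01 1))) (L * (h *+ 2 + e *+ 2)) L (M *+ 2) B.
move=> /(_ (@continuous_bounded_rv R (DD R) f M cf fM)
  (bounded_rv_sample uK cf fM) (bounded_rv_rJ1 _ _) mB) est.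
apply: le_trans (est _) _; last first.
  by rewrite lerD2l ler_wpM2l ?mulrn_wge0// ltW.
move=> x; rewrite indicE; have [xB|xB] := boolP (x \in B).
  have g0 := rJ1_ge0 (x (u k)) (x (pt01 1)).
  have h0 : 0 <= h.
    have [_ _ uinc] := uK.
    by apply: le_trans (uh 0%N isT); rewrite subr_ge0 ltW// uinc.
  apply: (@le_trans _ _ (M *+ 2)); last first.
    rewrite mulr1 lerDr addr_ge0// mulr_ge0// addr_ge0// mulrn_wge0//.
    exact: ltW.
  by rewrite mulr2n (le_trans (ler_normB _ _))// lerD.
rewrite mulr0 addr0 -mulrDr; apply: (le_trans (fL _ _)); rewrite ler_wpM2l//.
apply: rD_sample_w2D hd _ e0 => //; rewrite ltNge; apply/negP => xw.
by move: xB; rewrite (mem_set (AB x xw)).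
Qed.

(** Since the truncated distance is at most 1, its expectation is at most e / 2
    plus the probability that it exceeds e / 2. *)
Lemma expectation_end_gap Q :
  (forall eps : R, 0 < eps ->
     outer_prob Q
       [set x : DD R | (eps%:E <= dJ1 (x (pt01 1)) (x (pt01 (1 - delta))))%E]
       @[delta --> 0^'+] --> 0%E) ->
  forall e, 0 < e -> exists2 r, 0 < r & forall t : I01 R, 1 - r < tm t ->
    tm t < 1 -> \int[Q]_x rJ1 (x t) (x (pt01 1)) < e.
Proof.
move=> h4 e e0; have e20 : 0 < e / 2 by rewrite divr_gt0.
have : \forall delta \near 0^'+, (outer_prob Q [set x : DD R |
  ((e / 2)%:E <= dJ1 (x (pt01 1)) (x (pt01 (1 - delta))))%E] < (e / 2)%:E)%E.
  apply: (h4 _ e20 [set y | (y < (e / 2)%:E)%E]).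
  by apply: lt_nbhsl; move: e20; rewrite -lte_fin.
move=> [r /= r0 rP]; exists r => // t rt t1.
have := rP (1 - tm t); rewrite /= subKr tmK => /(_ _ _)/outer_cover.
case.
- by rewrite sub0r normrN gtr0_norm ?subr_gt0//; lra.
- by rewrite subr_gt0.
move=> B [mB AB PB].
have bz : bounded_rv (fun _ : borel (DD R) => 0 : R).
  by split => //; exists 0 => x; rewrite normr0.
have z : \int[Q]_x (0 : R) = 0 by rewrite Rintegral_cst// mul0r.
have := @bounded_rv_dist_le _ _ _ Q (fun x => rJ1 (x t) (x (pt01 1)))
  (fun=> 0) (fun=> 0) (e / 2) 0 1 B.
move=> /(_ (bounded_rv_rJ1 _ _) bz bz mB); rewrite z subr0 mul0r addr0 => est.
apply: le_lt_trans (ler_norm _) _; apply: le_lt_trans (est _) _; last by lra.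
move=> x; rewrite subr0 mul1r ger0_norm ?rJ1_ge0// indicE.
have [xB|xB] := boolP (x \in B).
  by apply: (le_trans (rJ1_le1 _ _)); rewrite /=; lra.
rewrite addr0 leNgt; apply/negP => xe; move: xB; rewrite mem_set//; apply: AB.
rewrite /= dJ1_sym; apply: le_trans (trunc_dist_le_dist (@dJ1_ge0 R) _ _).
by rewrite lee_fin; exact: ltW.
Qed.

End sampling_expectations.

Theorem theorem3p9 (R : realType)
    (P_ : nat -> probability (borel (DD R)) R)
    (P : probability (borel (DD R)) R)
    (h1 : forall (k : nat) (t : 'I_k -> I01 R), (0 < k)%N ->
       (forall i, TP P (t i)) ->
       weak_cvg (Dpow R k)
                (fun n => pushforward (P_ n) (projs t))
                (pushforward P (projs t)))
    (h2a : forall eps : R, 0 < eps ->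
       limn_esup (fun n => outer_prob (P_ n)
         [set x : DD R | exists t : I01 R, (eps%:E <= w2 (x t) delta)%E])
         @[delta --> 0^'+] --> 0%E)
    (h2b : forall eps : R, 0 < eps ->
       limn_esup (fun n => outer_prob (P_ n)
         [set x : DD R | exists t : I01 R,
            eps <= `|x t (pt01 delta) - x t (pt01 0)|])
         @[delta --> 0^'+] --> 0%E)
    (h2c : forall eps : R, 0 < eps ->
       limn_esup (fun n => outer_prob (P_ n)
         [set x : DD R | exists t : I01 R,
            eps <= `|lim1 (x t) - x t (pt01 (1 - delta))|])
         @[delta --> 0^'+] --> 0%E)
    (h3 : forall eps : R, 0 < eps ->
       limn_esup (fun n => outer_prob (P_ n)
         [set x : DD R | (eps%:E <= w2D x delta)%E])
         @[delta --> 0^'+] --> 0%E)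
    (h4 : forall eps : R, 0 < eps ->
       outer_prob P
         [set x : DD R | (eps%:E <= dJ1 (x (pt01 1)) (x (pt01 (1 - delta))))%E]
         @[delta --> 0^'+] --> 0%E) :
  weak_cvg (DD R) P_ P.
Proof.
apply: weak_cvg_lipschitz => f L M L0 fL fM.
have cf := lipschitz_rD_continuous L0 fL.
have M0 : 0 <= M by apply: le_trans (fM (point : DD R)).
apply/cvgrPdist_lt => e e0.
have C0 : 0 < L * 6 + M * 2 + 3 by rewrite ltr_wpDl// addr_ge0// mulr_ge0.
(* z bounds each elementary error: L * 6 collects the mesh, the modulus and
   the gap at 1, M * 2 the exceptional event, two more z come from the
   convergence for the sampled paths, and the last one makes the bound strict *)
pose z := e / (L * 6 + M * 2 + 3).
have z0 : 0 < z by rewrite divr_gt0.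
have zE : z * (L * 6 + M * 2 + 3) = e by rewrite divfK// gt_eqF.
have [delta [delta0 hdelta]] : exists delta : R, 0 < delta /\
    (limn_esup (fun n => outer_prob (P_ n)
       [set x : DD R | (z%:E <= w2D x delta)%E]) < z%:E)%E.
  have H : \forall delta \near 0^'+, (limn_esup (fun n => outer_prob (P_ n)
       [set x : DD R | (z%:E <= w2D x delta)%E]) < z%:E)%E.
    apply: (h3 _ z0 [set y | (y < z%:E)%E]); apply: lt_nbhsl.
    by move: z0; rewrite -lte_fin.
  near (0 : R)^'+ => delta; exists delta; split; near: delta => //.
  exact: nbhs_right_gt.
have [r r0 gapP] := expectation_end_gap h4 z0.
have /choice[u uP] := ex_TP_grid P.
have uK N : is_grid N.+2 (u N) by have [] := uP N.
have uT N i : TP P (u N i) by have [] := uP N.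
have uh N i : (i < N.+2)%N -> tm (u N i.+1) - tm (u N i) <= 2 / N.+1%:R.
  by have [_ _] := uP N; apply.
have mesh0 d : 0 < d -> \forall N \near \oo, 2 / N.+1%:R < d :> R.
  move=> d0; have d20 : 0 < d / 2 by rewrite divr_gt0.
  apply: filterS (near_infty_natSinv_lt (PosNum d20)) => N /=.
  by rewrite ltr_pdivlMr// mulrC.
have samples : \int[P]_x f (sample (uK N) x) @[N --> \oo] --> \int[P]_x f x.
  apply: (@bounded_rv_cvg _ _ _ P (fun N x => f (sample (uK N) x)) f M) => //.
  - by move=> N; have [] := bounded_rv_sample (uK N) cf fM.
  - move=> x.
    apply: (@cvg_comp _ _ _ (fun N => sample (uK N) x) f _ (nbhs x));
      last exact: cf.
    move=> U /nbhs_rDP[d d0 dU].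
    have d20 : 0 < d / 2 by rewrite divr_gt0.
    have [d' d'0 xd'] := rD_sample_small x d20.
    apply: filterS (mesh0 _ d'0) => N Nd'; apply: dU.
    apply: (@le_lt_trans _ _ (d / 2)); last by lra.
    by apply: xd' => i iN; apply: le_trans (uh N i iN) (ltW Nd').
  - exact: (@continuous_bounded_rv R (DD R) f M cf fM).
have [N [Nz Nd Nr Ns]] : exists N : nat, [/\ 2 / N.+1%:R < z,
    2 / N.+1%:R < delta, 2 / N.+1%:R < r &
    `|\int[P]_x f x - \int[P]_x f (sample (uK N) x)| < z].
  near \oo => N; exists N; split; near: N.
  - exact: mesh0.
  - exact: mesh0.
  - exact: mesh0.
  - by move/cvgrPdist_lt : samples; apply.
have gapN : \int[P]_x rJ1 (x (u N N.+1)) (x (pt01 1)) < z.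
  have [_ u1 uinc] := uK N; apply: gapP.
    by have := le_lt_trans (uh N N.+1 (ltnSn _)) Nr; rewrite u1; lra.
  by rewrite -u1 uinc.
pose t (i : 'I_N.+3) : I01 R := u N i.
have tT i : TP P (t i) by exact: uT.
have fN : \int[P_ n]_x f (sample (uK N) x) @[n --> \oo] -->
    \int[P]_x f (sample (uK N) x).
  apply: (@fdd_expectation _ P_ P h1 _ t (fun a => f (step (uK N) a)) M) => //.
  by move=> a; apply: continuous_comp; [exact: step_continuous|exact: cf].
have gN : \int[P_ n]_x rJ1 (x (u N N.+1)) (x (pt01 1)) @[n --> \oo] -->
    \int[P]_x rJ1 (x (u N N.+1)) (x (pt01 1)).
  have e1 : pt01 1 = u N N.+2.
    by apply: tm_inj; have [_ -> _] := uK N; rewrite tm1.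
  rewrite e1.
  have := @fdd_expectation _ P_ P h1 _ t
    (fun a => rJ1 (a (inord N.+1)) (a ord_max)) 1 isT tT.
  rewrite /projs/Defs.proj/t/= inordK//; apply.
    exact: rJ1_coord_continuous.
  by move=> a; rewrite ger0_norm ?rJ1_ge0 ?rJ1_le1.
near=> n.
have h_n : (outer_prob (P_ n)
    [set x : DD R | (z%:E <= w2D x delta)%E] < z%:E)%E.
  by near: n; exact: limn_esup_lt.
have f_n : `|\int[P]_x f (sample (uK N) x) -
             \int[P_ n]_x f (sample (uK N) x)| < z.
  by near: n; move/cvgrPdist_lt : fN; apply.
have g_n : `|\int[P]_x rJ1 (x (u N N.+1)) (x (pt01 1)) -
             \int[P_ n]_x rJ1 (x (u N N.+1)) (x (pt01 1))| < z.
  by near: n; move/cvgrPdist_lt : gN; apply.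
have := expectation_sample_dist (uK N) L0 fL fM (uh N) (ltW Nd) z0 h_n.
move: gapN Ns f_n g_n; rewrite !ltr_distl ler_distl.
set h := 2 / _ in Nz *.
set Eg := \int[P]_x _ ; set Egn := \int[P_ n]_x rJ1 _ _.
move=> gz /andP[a1 a2] /andP[b1 b2] /andP[c1 c2] /andP[d1 d2].
have l1 : L * (h *+ 2 + z *+ 2) + L * Egn <= L * (6 * z).
  by rewrite -mulrDr ler_wpM2l//; clear -Nz gz c1; lra.
by clear -z0 zE l1 a1 a2 b1 b2 d1 d2; apply/andP; split; lra.
Unshelve. all: by end_near. Qed.
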